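(* Let $1\le d_1<\dots<d_s\le n-1$ and let $\mathcal F^a=\mathcal F^a(d_1,\dots,d_s)$, regarded as a subvariety of $\prod_{i=1}^sGr(d_i,n)$. Then there exists a cell decomposition $$\mathcal F^a=\bigsqcup_{\mathbf I}C_{\mathbf I},\qquad C_{\mathbf I}=(G^a\cdot p_{I^1}\times\dots\times G^a\cdot p_{I^s})\cap\mathcal F^a,$$ where $\mathbf I=(I^1,\dots,I^s)$ runs over all collections of subsets $I^l\subset\{1,\dots,n\}$ with $\#I^l=d_l$ satisfying $$I^l\setminus\{d_l+1,\dots,d_{l+1}\}\subset I^{l+1},\qquad l=1,\dots,s-1.$$ That is, $\mathcal F^a$ is the disjoint union of the $C_{\mathbf I}$ and each $C_{\mathbf I}$ is an affine cell (isomorphic to an affine space).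
   Context: Everything is over $\mathbb{C}$. $Gr(d,n)$ is the Grassmannian of $d$-dimensional subspaces of $V=\mathbb{C}^n$ with basis $v_1,\dots,v_n$. For $L\subset\{1,\dots,n\}$ with $\#L=d$, $p_L=\mathrm{span}(v_l:l\in L)\in Gr(d,n)$. Let $\mathfrak{g}=\mathfrak{sl}_n=\mathfrak{n}\oplus\mathfrak{h}\oplus\mathfrak{n}^-$ be the standard Cartan decomposition (strictly upper triangular, diagonal, strictly lower triangular), $\mathfrak b=\mathfrak n\oplus\mathfrak h$, $B\subset SL_n$ the Borel subgroup with Lie algebra $\mathfrak b$, $M=\dim\mathfrak{n}$. The degenerate algebra is $\mathfrak g^a=\mathfrak b\oplus(\mathfrak n^-)^a$, where $(\mathfrak n^-)^a$ is an abelian ideal equal to $\mathfrak n^-$ as a vector space, and $\mathfrak b$ acts on it via the identification $(\mathfrak n^-)^a\simeq\mathfrak g/\mathfrak b$. The corresponding group is $G^a=B\ltimes\mathbb G_a^M$, with $\mathbb G_a$ the additive group of the field and $\mathbb G_a^M$ the group of $(\mathfrak n^-)^a$. For a dominant integral weight $\lambda$ let $V_\lambda$ be the irreducible $\mathfrak g$-module with highest weight vector $v_\lambda$, and $F_s=\mathrm{span}\{x_1\cdots x_l v_\lambda: x_i\in\mathfrak g,\ l\le s\}$ the PBW filtration. The associated graded space $V_\lambda^a=\bigoplus_{s\ge0}F_s/F_{s-1}$ ($F_{-1}=0$) is naturally a $\mathfrak g^a$-module and a $G^a$-module: $x\in(\mathfrak n^-)^a$ acts by the induced maps $F_s/F_{s-1}\to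 F_{s+1}/F_s$ and $\mathfrak b$ by the induced maps $F_s/F_{s-1}\to F_s/F_{s-1}$. The degenerate flag variety is the closure $\mathcal F^a_\lambda=\overline{\mathbb G_a^M\cdot\mathbb C v_\lambda}\subset\mathbb P(V^a_\lambda)$. With $\omega_d$ the fundamental weights, $\mathcal F^a(d_1,\dots,d_s)=\mathcal F^a_{\omega_{d_1}+\dots+\omega_{d_s}}$. Embedding into Grassmannians: $V_{\omega_d}=\Lambda^d V$ with basis $v_J=v_{j_1}\wedge\dots\wedge v_{j_d}$, $J=\{j_1<\dots<j_d\}$ and highest weight vector $v_1\wedge\dots\wedge v_d$; the vector $v_J$ lies in PBW degree $\#\{j\in J:j>d\}$, and $V^a_{\omega_d}$ is identified with $\Lambda^dV$ by identifying the class of $v_J$ with $v_J$. Under this identification $\mathcal F^a_{\omega_d}=Gr(d,n)\subset\mathbb P(\Lambda^dV)$ (Plücker embedding), which gives the action of $G^a$ on $Gr(d,n)$ (different from the action of $SL_n$). Explicitly, writing $\alpha_{i,j}=\alpha_i+\dots+\alpha_j$ ($1\le i\le j\le n-1$) for the positive roots, $f_{i,j},e_{i,j}$ for the root vectors of weights $-\alpha_{i,j},\alpha_{i,j}$, and $R_d=\{\alpha_{i,j}:i\le d\le j\}$: on $V_{\omega_d}^a=\Lambda^dV$ the $f_\alpha$ with $\alpha\notin R_d$ and the $e_\alpha$ with $\alpha\in R_d$ act by zero, while $f_\alpha$ ($\alpha\in R_d$), $\mathfrak h$ and $e_\alpha$ ($\alpha\notin R_d$) act as in the usual $\mathfrak{sl}_n$-module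 $\Lambda^dV$. For all dominant $\lambda,\mu$ there is an embedding of $G^a$-modules $V^a_{\lambda+\mu}\hookrightarrow V^a_\lambda\otimes V^a_\mu$ sending $v_{\lambda+\mu}$ to $v_\lambda\otimes v_\mu$, which induces an embedding $\mathcal F^a_{\lambda+\mu}\hookrightarrow\mathcal F^a_\lambda\times\mathcal F^a_\mu$. Iterating gives the embedding $\mathcal F^a(d_1,\dots,d_s)\hookrightarrow\prod_{i=1}^sGr(d_i,n)$. *)

(* Defs.v *)
From HB Require Import structures.
From mathcomp Require Import all_boot all_order all_algebra.
From mathcomp Require Import reals complex mpoly.

Set Implicit Arguments.
Unset Strict Implicit.
Unset Printing Implicit Defensive.

Import GRing.Theory.
Local Open Scope ring_scope.

(* Indices are shifted by one: the basis v_1, ..., v_n of V is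
   delta_mx i 0 : 'cV_n for i : 'I_n, so "j <= d" becomes j < d. *)

Section LieAlgebra.
Variables (K : fieldType) (n : nat).

Definition in_sl (x : 'M[K]_n) : Prop := \tr x = 0.
Definition strict_upper (x : 'M[K]_n) : Prop :=
  forall i j : 'I_n, (j <= i)%N -> x i j = 0.
Definition strict_lower (x : 'M[K]_n) : Prop := strict_upper x^T.
Definition in_borel (x : 'M[K]_n) : Prop := is_trig_mx x^T /\ in_sl x.
Definition in_Borel (b : 'M[K]_n) : Prop := is_trig_mx b^T /\ \det b = 1.

(* The fundamental weight omega_d, as a function on diagonal matrices. *)
Definition fund_weight (d : nat) (h : 'M[K]_n) : K :=
  \sum_(k < n | (k < d)%N) h k k.

(* A representation of sl_n is given by a linear map on all matrices of which
   only the values on traceless ones matter. *)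
Record irreducible_highest_weight (V : vectType K)
    (rho : {linear 'M[K]_n -> 'End(V)}) (v : V) (lambda : 'M[K]_n -> K) : Prop :=
  IrreducibleHighestWeight {
    rho_bracket : forall x y, in_sl x -> in_sl y ->
      rho (x *m y - y *m x) = (rho x \o rho y - rho y \o rho x)%VF;
    rho_irreducible : forall U : {vspace V},
      (forall x, in_sl x -> (rho x @: U <= U)%VS) ->
      U = 0%VS \/ U = fullv;
    hw_neq0 : v != 0;
    hw_nilp : forall x, strict_upper x -> rho x v = 0;
    hw_diag : forall h, in_sl h -> is_diag_mx h -> rho h v = lambda h *: v }.

Definition in_span (V : lmodType K) (S : V -> Prop) (u : V) : Prop :=
  exists (m : nat) (c : 'I_m -> K) (w : 'I_m -> V),
    (forall k, S (w k)) /\ u = \sum_(k < m) c k *: w k.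

(* pbw rho v s is F_(s-1), the span of the x_1 ... x_l v with l < s; in
   particular pbw rho v 0 is F_(-1) = 0. *)
Definition pbw (V : vectType K) (rho : {linear 'M[K]_n -> 'End(V)}) (v : V)
    (s : nat) : V -> Prop :=
  in_span (fun u => exists xs : seq 'M[K]_n,
    [/\ (size xs < s)%N, forall x, x \in xs -> in_sl x &
        u = foldr (fun x w => rho x w) v xs]).

(* W is the direct sum over s of the quotients F_s / F_(s-1): gr s restricted
   to F_s is the projection onto the s-th summand (its values outside F_s are
   irrelevant). *)
Record associated_graded (V : vectType K)
    (rho : {linear 'M[K]_n -> 'End(V)}) (v : V)
    (W : vectType K) (gr : nat -> {linear V -> W}) : Prop :=
  AssociatedGraded {
    gr_ker : forall s u, pbw rho v s.+1 u -> gr s u = 0 <-> pbw rho v s u;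
    gr_sum : forall w, exists (m : nat) (u : nat -> V),
      (forall s, pbw rho v s.+1 (u s)) /\ w = \sum_(s < m) gr s (u s);
    gr_direct : forall (m : nat) (u : nat -> V),
      (forall s, pbw rho v s.+1 (u s)) -> \sum_(s < m) gr s (u s) = 0 ->
      forall s, (s < m)%N -> gr s (u s) = 0 }.

(* As a vector space g^a = b (+) n^- is identified with sl_n. *)
Record degenerate_action (V : vectType K)
    (rho : {linear 'M[K]_n -> 'End(V)}) (v : V)
    (W : vectType K) (gr : nat -> {linear V -> W})
    (act : {linear 'M[K]_n -> 'End(W)}) : Prop :=
  DegenerateAction {
    act_lower : forall y s u, strict_lower y -> pbw rho v s.+1 u ->
      act y (gr s u) = gr s.+1 (rho y u);
    act_borel : forall x s u, in_borel x -> pbw rho v s.+1 u ->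
      act x (gr s u) = gr s (rho x u) }.

(* Exponential of a nilpotent endomorphism, for which f ^ (dim E) = 0. *)
Definition nilp_exp (E : vectType K) (f : E -> E) (x : E) : E :=
  \sum_(k < (\dim {:E}).+1) (k`!)%:R^-1 *: iter k f x.

End LieAlgebra.

Section Projective.
Variable K : fieldType.

(* The affine cone, minus its vertex, over the Zariski closure in P(E) of the
   set of lines spanned by the nonzero elements of S. *)
Definition proj_closure (E : vectType K) (S : E -> Prop) (x : E) : Prop :=
  x != 0 /\
  forall (e : nat) (p : {mpoly K[\dim {:E}]}), p \is e.-homog ->
    (forall y, S y -> p.@[fun i => coord (vbasis {:E}) i y] = 0) ->
    p.@[fun i => coord (vbasis {:E}) i x] = 0.

(* The cone over F^a_lambda, the closure of the orbit of K v under the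
   group of (n^-)^a. *)
Definition degenerate_flag_cone (n : nat) (W : vectType K)
    (act : {linear 'M[K]_n -> 'End(W)}) (v : W) : W -> Prop :=
  proj_closure (fun w => exists2 y, strict_lower y & w = nilp_exp (act y) v).

End Projective.

Section Tensors.
Variables (K : fieldType) (n : nat).

(* The tensor power of V = 'cV_n with factors indexed by P, in coordinates. *)
Definition tensor (P : finType) := {ffun {ffun P -> 'I_n} -> K^o}.

Definition set_at (P : finType) (tau : {ffun P -> 'I_n}) (p : P) (a : 'I_n) :
    {ffun P -> 'I_n} := [ffun q => if q == p then a else tau q].

(* Action by derivations, the matrix X p acting on the factor p. *)
Definition tensor_lie (P : finType) (X : P -> 'M[K]_n) (t : tensor P) :
    tensor P :=
  [ffun tau : {ffun P -> 'I_n} =>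
     \sum_p \sum_a X p (tau p) a * t (set_at tau p a)].

Definition tensor_grp (P : finType) (g : P -> 'M[K]_n) (t : tensor P) :
    tensor P :=
  [ffun tau : {ffun P -> 'I_n} =>
     \sum_(sigma : {ffun P -> 'I_n}) (\prod_p g p (tau p) (sigma p)) * t sigma].

(* Lambda^d V is realized as the alternating tensors of order d, and
   u_1 /\ ... /\ u_d is the antisymmetrization of u_1 (x) ... (x) u_d. *)
Definition wedge (d : nat) (u : 'I_d -> 'cV[K]_n) : tensor 'I_d :=
  [ffun tau : {ffun 'I_d -> 'I_n} => \det (\matrix_(k, l) u l (tau k) 0)].

Definition wedge_hw (d : nat) : tensor 'I_d :=
  wedge (fun k : 'I_d => \col_(j < n) (j == k :> nat)%:R).

(* V_(omega_d)^a: the root vectors f_alpha, alpha \notin R_d, and e_alpha,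
   alpha \in R_d, act by zero, the rest of sl_n as usual. The entries (i, j)
   with i < d <= j are those of e_alpha with alpha \in R_d, the entries with
   j < d <= i those of f_alpha with alpha \in R_d. *)
Definition degen (d : nat) (x : 'M[K]_n) : 'M[K]_n :=
  \matrix_(i, j) if (if (i <= j)%N then ~~ (i < d <= j)%N else (j < d <= i)%N)
                 then x i j else 0.

(* The element exp(y) b of G^a, with y in (n^-)^a and b in B, acting on
   V_(omega_d)^a. For upper triangular b, degen d is multiplicative and keeps
   the two diagonal blocks, and its d-th exterior power is the map induced by b
   on the graded space. *)
Definition Ga_act (d : nat) (b y : 'M[K]_n) (t : tensor 'I_d) : tensor 'I_d :=
  nilp_exp (tensor_lie (fun=> degen d y)) (tensor_grp (fun=> degen d b) t).

(* The homogeneous Pluecker coordinate vectors of U; there is none unless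
   dim U = d. *)
Definition pluecker (d : nat) (U : {vspace 'cV[K]_n}) (t : tensor 'I_d) : Prop :=
  exists2 u : d.-tuple 'cV[K]_n, basis_of U u & t = wedge (tnth u).

Definition coord_space (L : {set 'I_n}) : {vspace 'cV[K]_n} :=
  span [seq (delta_mx l 0 : 'cV[K]_n) | l <- enum L].

Definition Ga_orbit (d : nat) (L : {set 'I_n}) (U : {vspace 'cV[K]_n}) : Prop :=
  exists b y, [/\ in_Borel b, strict_lower y &
    exists2 t : tensor 'I_d, pluecker (coord_space L) t &
                             pluecker U (Ga_act b y t)].

End Tensors.

Section FlagVarieties.
Variables (K : fieldType) (n s : nat) (d : 'I_s -> nat).

(* The factors of the tensor product of the Lambda^(d_i) V, i < s. *)
Definition slots : finType := {i : 'I_s & 'I_(d i)}.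

Definition Segre (t : forall i, tensor K n 'I_(d i)) : tensor K n slots :=
  [ffun tau : {ffun slots -> 'I_n} => \prod_(i < s)
     t i [ffun k : 'I_(d i) => tau (Tagged (fun i => 'I_(d i)) k)]].

Definition Ga_lie_tensor (x : 'M[K]_n) (t : tensor K n slots) :
    tensor K n slots :=
  tensor_lie (fun p : slots => degen (d (tag p)) x) t.

(* The embedding of V_lambda^a in the tensor product of the V_(omega_(d_i))^a. *)
Record cartan_embedding (W : vectType K) (act : {linear 'M[K]_n -> 'End(W)})
    (v : W) (iota : {linear W -> tensor K n slots}) : Prop :=
  CartanEmbedding {
    iota_inj : injective iota;
    iota_equiv : forall x w, in_sl x ->
      iota (act x w) = Ga_lie_tensor x (iota w);
    iota_hw : iota v = Segre (fun i => wedge_hw K n (d i)) }.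

(* The product of the Gr(d_i, n) consists of the families of subspaces U having
   Segre-Pluecker coordinates, and is a projective variety through them. *)
Definition family := {ffun 'I_s -> {vspace 'cV[K]_n}}.

Definition segre_pluecker (U : family) (t : tensor K n slots) : Prop :=
  exists2 p : forall i, tensor K n 'I_(d i),
    forall i, pluecker (U i) (p i) & t = Segre p.

Definition degenerate_flag (W : vectType K) (act : {linear 'M[K]_n -> 'End(W)})
    (v : W) (iota : {linear W -> tensor K n slots}) (U : family) : Prop :=
  exists2 w, degenerate_flag_cone act v w & segre_pluecker U (iota w).

Definition admissible (I : {ffun 'I_s -> {set 'I_n}}) : Prop :=
  (forall l, #|I l| = d l) /\
  (forall l l' : 'I_s, l' = l.+1 :> nat ->
     I l :\: [set j : 'I_n | (d l <= j < d l')%N] \subset I l').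

Definition cell (F : family -> Prop) (I : {ffun 'I_s -> {set 'I_n}})
    (U : family) : Prop :=
  (forall l, Ga_orbit (d l) (I l) (U l)) /\ F U.

Definition tensor_eval (p : {mpoly K[#|{ffun slots -> 'I_n}|]})
    (t : tensor K n slots) : K := p.@[fun k => t (enum_val k)].

(* Regular functions on a subset C of the product of Grassmannians: locally
   quotients of homogeneous polynomials of the same degree. *)
Definition regular_on (C : family -> Prop) (f : family -> K) : Prop :=
  forall U, C U ->
  exists (e : nat) (p q : {mpoly K[#|{ffun slots -> 'I_n}|]}),
    [/\ p \is e.-homog, q \is e.-homog,
        exists2 t, segre_pluecker U t & tensor_eval q t != 0 &
        forall U' t, C U' -> segre_pluecker U' t -> tensor_eval q t != 0 ->
          f U' = tensor_eval p t / tensor_eval q t].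

(* Morphisms from affine N-space: locally given by polynomials in homogeneous
   coordinates. *)
Definition regular_from (N : nat) (phi : 'rV[K]_N -> family) : Prop :=
  forall a, exists g : {ffun slots -> 'I_n} -> {mpoly K[N]},
    let g_at (b : 'rV[K]_N) : tensor K n slots :=
      [ffun tau : {ffun slots -> 'I_n} => (g tau).@[fun k => b 0 k]] in
    g_at a != 0 /\ forall b, g_at b != 0 -> segre_pluecker (phi b) (g_at b).

Definition affine_cell (C : family -> Prop) : Prop :=
  exists (N : nat) (phi : 'rV[K]_N -> family) (psi : family -> 'rV[K]_N),
    [/\ forall a, C (phi a), cancel phi psi, forall U, C U -> phi (psi U) = U,
        regular_from phi & forall k, regular_on C (fun U => psi U 0 k)].

End FlagVarieties.

(* Main.v *)
Require Import Defs.
From HB Require Import structures.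
From mathcomp Require Import all_boot all_order all_algebra.
From mathcomp Require Import perm boolp reals complex mpoly zify ring.

(* F^a is the variety of the families (U_l) with dim U_l = d_l such that the projection pr_l
   killing v_(d_l + 1), ..., v_(d_(l+1)) maps U_l into U_(l+1).  By Cramer's rule this incidence
   is linear in the Segre-Pluecker coordinates; it holds on the orbit of the highest weight line,
   hence on its closure.  Conversely, let I_l be spanned by the v_i with i > d_l.  If all the
   intersections of U_l and I_l vanish, then U is in the orbit.  Otherwise U is the value at
   t = 0 of an explicit polynomial family of incident U(t) for which the sum of the dimensions of
   these intersections is smaller whenever t <> 0; by induction, a homogeneous polynomial
   vanishing on the orbit vanishes at U(t) for t <> 0, hence at U.

   The orbits of G^a on Gr(d, n) are the Schubert cells for the order d+1, ..., n, 1, ..., d of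
   the basis, so each U_l is in the orbit of p_(I^l) for exactly one I^l, the set of its leading
   indices.  A leading index of U_l which pr_l does not kill is a leading index of U_(l+1).
   Describe U_l in its cell by the reduced projection E_l onto U_l along the coordinate subspace
   complementary to I^l.  The incidence says E_(l+1) pr_l E_l = pr_l E_l, and its solutions are
   E_(l+1) = F + (1 - F) pr_l E_l, where F consists of the columns of E_(l+1) whose index is not a
   leading index of pr_l U_l and can be chosen freely.  The free entries are the affine
   coordinates. *)

Set Implicit Arguments.
Unset Strict Implicit.
Unset Printing Implicit Defensive.

Import GRing.Theory.
Local Open Scope ring_scope.

(** * Pluecker coordinates *)

Section Wedge.
Variables (K : fieldType) (n d : nat).
Implicit Types (A : 'M[K]_(n, d)) (tau : {ffun 'I_d -> 'I_n}).

Definition wedge_mx A : tensor K n 'I_d := wedge (fun l => col l A).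

Lemma wedge_mxE A tau : wedge_mx A tau = \det (rowsub tau A).
Proof. by rewrite ffunE; congr (\det _); apply/matrixP=> i j; rewrite !mxE. Qed.

Lemma wedgeE (u : 'I_d -> 'cV[K]_n) : wedge u = wedge_mx (\matrix_(i, l) u l i 0).
Proof.
apply/ffunP=> tau; rewrite wedge_mxE ffunE; congr (\det _).
by apply/matrixP=> i j; rewrite !mxE.
Qed.

Lemma rowsub_mulmx m p (f : 'I_p -> 'I_n) A (B : 'M_(d, m)) :
  rowsub f (A *m B) = rowsub f A *m B.
Proof. by apply/matrixP=> i j; rewrite !mxE; apply: eq_bigr=> k _; rewrite !mxE. Qed.

Lemma tensor_grp_wedge (g : 'M[K]_n) A :
  tensor_grp (fun=> g) (wedge_mx A) = wedge_mx (g *m A).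
Proof.
apply/ffunP=> tau; rewrite wedge_mxE !ffunE /determinant.
under eq_bigr => sg _ do rewrite wedge_mxE /determinant mulr_sumr.
rewrite exchange_big; apply: eq_bigr=> s _ /=.
under eq_bigr => sg _ do rewrite mulrCA -big_split.
rewrite -mulr_sumr; congr (_ * _).
transitivity (\prod_k \sum_i g (tau k) i * A i (s k)); last first.
  by apply: eq_bigr=> k _; rewrite !mxE.
rewrite bigA_distr_bigA; apply: eq_bigr=> f _; apply: eq_bigr=> k _.
by rewrite mxE.
Qed.

(* Laplace expansion along the replaced row [k]. *)
Lemma wedge_mx_set_at A tau k i :
  wedge_mx A (set_at tau k i) = (A *m \adj (rowsub tau A)) i k.
Proof.
rewrite wedge_mxE (expand_det_row _ k) !mxE; apply: eq_bigr=> j _.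
rewrite !mxE ffunE eqxx; congr (_ * (_ * \det _)).
by apply/matrixP=> a b; rewrite !mxE ffunE eq_sym (negbTE (neq_lift _ _)).
Qed.
End Wedge.

(** * Column spaces and their Pluecker vectors *)

Section MatrixMap.
Variable K : fieldType.

Definition mxlfun n m (A : 'M[K]_(n, m)) : 'Hom('cV[K]_m, 'cV[K]_n) :=
  linfun (mulmx A).

Lemma mxlfunE n m (A : 'M[K]_(n, m)) x : mxlfun A x = A *m x.
Proof. by rewrite lfunE. Qed.

End MatrixMap.

Section ColumnSpace.
Variables (K : fieldType) (n : nat).

Definition colsp m (A : 'M[K]_(n, m)) : {vspace 'cV[K]_n} := limg (mxlfun A).

Lemma colspP m (A : 'M[K]_(n, m)) x :
  reflect (exists y, x = A *m y) (x \in colsp A).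
Proof.
apply: (iffP memv_imgP) => [[y _ ->]|[y ->]]; first by exists y; rewrite mxlfunE.
by exists y; rewrite ?memvf ?mxlfunE.
Qed.

Lemma mem_colsp m (A : 'M[K]_(n, m)) y : A *m y \in colsp A.
Proof. by apply/colspP; exists y. Qed.

Lemma col_colsp m (A : 'M[K]_(n, m)) j : col j A \in colsp A.
Proof. by rewrite colE mem_colsp. Qed.

Lemma colspM m p (A : 'M[K]_(n, m)) (B : 'M_(m, p)) : (colsp (A *m B) <= colsp A)%VS.
Proof. by apply/subvP=> x /colspP[y ->]; rewrite -mulmxA mem_colsp. Qed.

Lemma colsp_subP m p (A : 'M[K]_(n, m)) (B : 'M_(n, p)) :
  (colsp A <= colsp B)%VS -> exists C, A = B *m C.
Proof.
move=> sAB.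
have /fin_all_exists[c cE] : forall j, exists y, col j A = B *m y.
  by move=> j; apply/colspP/(subvP sAB)/col_colsp.
exists (\matrix_(i, j) c j i 0); apply/matrixP=> i j.
have /matrixP/(_ i 0) := cE j; rewrite !mxE => ->.
by apply: eq_bigr=> k _; rewrite !mxE.
Qed.

Lemma colsp_eqP m p (A : 'M[K]_(n, m)) (B : 'M_(n, p)) (f : 'M_(m, p)) (g : 'M_(p, m)) :
  A *m f = B -> B *m g = A -> colsp A = colsp B.
Proof.
move=> <- e; apply/eqP; rewrite eqEsubv colspM andbT.
by rewrite -{1}e; exact: colspM.
Qed.

Lemma span_colsp d (u : d.-tuple 'cV[K]_n) :
  <<u>>%VS = colsp (\matrix_(i, l) tnth u l i 0).
Proof.
set A := \matrix_(i, l) _.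
have cA l : col l A = tnth u l by apply/colP=> i; rewrite !mxE.
apply/eqP; rewrite eqEsubv; apply/andP; split.
  by apply/span_subvP=> x /tnthP[l ->]; rewrite -cA col_colsp.
apply/subvP=> x /colspP[y ->].
rewrite (_ : A *m y = \sum_l y l 0 *: tnth u l).
  by apply: memv_suml=> l _; rewrite memvZ // memv_span // mem_tnth.
apply/colP=> i; rewrite summxE mxE; apply: eq_bigr=> l _.
by rewrite !mxE mulrC.
Qed.

Lemma row_full_inj m (A : 'M[K]_(n, m)) :
  reflect (forall y : 'cV_m, A *m y = 0 -> y = 0) (row_full A).
Proof.
apply: (iffP idP) => [/row_fullP[B BA] y Ay|inj].
  by rewrite -[y]mul1mx -BA -mulmxA Ay mulmx0.
rewrite /row_full -mxrank_tr; apply/inj_row_free => v /(congr1 trmx).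
by rewrite trmx_mul trmxK trmx0 => /inj/(congr1 trmx); rewrite trmxK trmx0.
Qed.

Lemma pluecker_wedge_mx d (A : 'M[K]_(n, d)) :
  row_full A -> pluecker (colsp A) (wedge_mx A).
Proof.
move=> fA; have [u uE] : exists u : d.-tuple 'cV[K]_n, forall l, tnth u l = col l A.
  by exists [tuple col l A | l < d] => l; rewrite tnth_mktuple.
have uA : \matrix_(i, l) tnth u l i 0 = A.
  by apply/matrixP=> i l; rewrite !mxE uE mxE.
exists u; last by rewrite wedgeE uA.
rewrite /basis_of span_colsp uA eqxx /=; apply/freeP=> k.
move=> e; have /(row_full_inj _ fA)/colP k0 : A *m \col_i k i = 0.
  rewrite -[RHS]e; apply/colP=> i; rewrite summxE mxE; apply: eq_bigr=> l _.
  by rewrite -tnth_nth uE !mxE mulrC.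
by move=> i; have := k0 i; rewrite !mxE.
Qed.

Lemma plueckerP d (U : {vspace 'cV[K]_n}) (t : tensor K n 'I_d) :
  pluecker U t <-> exists A : 'M_(n, d), [/\ row_full A, U = colsp A & t = wedge_mx A].
Proof.
split=> [[u /andP[/eqP su /freeP fu] ->]|[A [fA -> ->]]]; last exact: pluecker_wedge_mx.
exists (\matrix_(i, l) tnth u l i 0); split; last exact: wedgeE.
  apply/row_full_inj=> y Ay; apply/colP=> l; rewrite mxE.
  apply: (fu (fun l => y l 0)); rewrite -[RHS]Ay.
  apply/colP=> i; rewrite summxE [RHS]mxE; apply: eq_bigr=> k _.
  by rewrite -tnth_nth !mxE mulrC.
by rewrite -su span_colsp.
Qed.

Lemma dim_pluecker d (U : {vspace 'cV[K]_n}) (t : tensor K n 'I_d) : pluecker U t -> \dim U = d.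
Proof. by case=> u /vector.size_basis. Qed.

Lemma dim_colsp d (A : 'M[K]_(n, d)) : row_full A -> \dim (colsp A) = d.
Proof. by move/pluecker_wedge_mx/dim_pluecker. Qed.

Lemma row_full_minor d (A : 'M[K]_(n, d)) :
  row_full A -> exists tau : {ffun 'I_d -> 'I_n}, rowsub tau A \in unitmx.
Proof.
move=> fA; exists (finfun (fullrankfun fA)).
have -> : rowsub (finfun (fullrankfun fA)) A = rowsub (fullrankfun fA) A.
  by apply/matrixP=> i j; rewrite !mxE ffunE.
exact: fullrowsub_unit.
Qed.

Lemma unit_minor_row_full d (A : 'M[K]_(n, d)) (tau : 'I_d -> 'I_n) :
  rowsub tau A \in unitmx -> row_full A.
Proof.
move=> uA; apply/row_full_inj=> y Ay.
by rewrite -[y](mulKmx uA) -rowsub_mulmx Ay; apply/colP=> i; rewrite !mxE big1// => j _; rewrite !mxE mulr0.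
Qed.

(** By [wedge_mx_set_at] the matrix on the right is [A] times the adjugate of its minor at [tau], an
    invertible factor. Hence a Pluecker vector determines its subspace. *)
Lemma colsp_minor d (A : 'M[K]_(n, d)) (tau : {ffun 'I_d -> 'I_n}) :
  rowsub tau A \in unitmx -> colsp A = colsp (\matrix_(i, k) wedge_mx A (set_at tau k i)).
Proof.
move=> uA; set B := \matrix_(i, k) _.
have eB : A *m \adj (rowsub tau A) = B.
  by apply/matrixP=> i k; rewrite [RHS]mxE wedge_mx_set_at.
apply: (colsp_eqP eB (g := (\det (rowsub tau A))^-1 *: rowsub tau A)).
rewrite -eB -mulmxA -scalemxAr mul_adj_mx scale_scalar_mx mulVf ?mulmx1 //.
by rewrite -unitfE.
Qed.

Lemma pluecker_inj d (U U' : {vspace 'cV[K]_n}) (t : tensor K n 'I_d) :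
  pluecker U t -> pluecker U' t -> U = U'.
Proof.
move=> /plueckerP[A [fA -> ->]] /plueckerP[B [fB -> tE]].
have [tau uA] := row_full_minor fA.
have uB : rowsub tau B \in unitmx.
  by move: uA; rewrite !unitmxE -!wedge_mxE tE.
rewrite (colsp_minor uA) (colsp_minor uB); congr colsp.
by apply/matrixP=> i k; rewrite !mxE tE.
Qed.

Lemma pluecker_exists d (U : {vspace 'cV[K]_n}) : \dim U = d ->
  exists2 A : 'M_(n, d), row_full A & U = colsp A.
Proof.
move=> <-; have /plueckerP[A [fA UA _]] : pluecker U (wedge (tnth (vbasis U))).
  by exists (vbasis U) => //; exact: vbasisP.
by exists A.
Qed.

End ColumnSpace.

Lemma limg_colsp (K : fieldType) n m p (B : 'M[K]_(n, p)) (A : 'M[K]_(p, m)) :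
  (mxlfun B @: limg (mxlfun A))%VS = colsp (B *m A).
Proof.
rewrite -limg_comp; congr (limg _); apply/lfunP=> x.
by rewrite comp_lfunE !mxlfunE mulmxA.
Qed.

(** * Exponentials of tensor operators *)

Section NilpotentExponential.
Variables (K : fieldType) (E : vectType K) (f : {linear E -> E}).

Lemma iter_linear k : linear (iter k f).
Proof. by elim: k => [|k IH] a x y //=; rewrite IH linearP. Qed.

Lemma iter_raddf0 k : iter k f 0 = 0.
Proof. by elim: k => [|k IH] //=; rewrite IH raddf0. Qed.

(** The highest power of [f] that does not kill [x] kills all later iterates, so [x] is not in their
    span. *)
Lemma free_traject k x :
  iter k f x != 0 -> iter k.+1 f x = 0 -> free (traject f x k.+1).
Proof.
elim: k x => [|k IH] x fx0 fx1; first by rewrite [traject _ _ _]/= free_cons span_nil memv0 fx0 nil_free.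
rewrite trajectS free_cons IH -?iterSr // andbT.
apply: contra fx0 => xs; pose L := GRing.isLinear.Build _ _ _ _ _ (iter_linear k.+1).
pose g : {linear E -> E} := HB.pack (iter k.+1 f) L.
have sk : (<<traject f (f x) k.+1>> <= lker (linfun g))%VS.
  apply/span_subvP=> y /trajectP[i _ ->]; rewrite memv_ker lfunE; apply/eqP.
  rewrite [LHS](_ : _ = iter (i + k.+2) f x); first by rewrite iterD fx1 iter_raddf0.
  have -> : (i + k.+2 = k.+1 + i.+1)%N by rewrite addnC addSnnS.
  by rewrite iterD (iterSr i).
by move/subvP: sk => /(_ _ xs); rewrite memv_ker lfunE.
Qed.

(** The iterates before the first zero one are free, so there are at most [\dim {:E}] of them. *)
Lemma iter_nilp k x : iter k f x = 0 -> iter (\dim {:E}) f x = 0.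
Proof.
move=> fk; apply/eqP; apply: contraT => fd0.
have [k0 /eqP fk0 kmin] : exists2 k0, iter k0 f x == 0 & forall m, iter m f x == 0 -> (k0 <= m)%N.
  have ex : exists k, iter k f x == 0 by exists k; apply/eqP.
  by exists (ex_minn ex); case: ex_minnP.
have ltk : (\dim {:E} < k0)%N.
  rewrite ltnNge; apply: contra fd0 => le.
  by rewrite -(subnK le) iterD fk0 iter_raddf0.
case: k0 => [|k0] in fk0 kmin ltk *; first by [].
have fr : free (traject f x k0.+1).
  apply: free_traject fk0; apply/negP=> /kmin; by rewrite ltnn.
move: fr; rewrite /free size_traject => /eqP e.
by have := dimvS (subvf <<traject f x k0.+1>>); rewrite e leqNgt ltk.
Qed.

(** Any order of nilpotency at [x] may truncate the series. This lets exponentials be compared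
    across [iota], whose source and target may have different dimensions. *)
Lemma nilp_expE m x : iter m f x = 0 ->
  nilp_exp f x = \sum_(k < m) (k`!)%:R^-1 *: iter k f x.
Proof.
have shrink p q : (p <= q)%N -> iter p f x = 0 ->
    \sum_(k < q) (k`!)%:R^-1 *: iter k f x = \sum_(k < p) (k`!)%:R^-1 *: iter k f x.
  move=> lepq fp0; rewrite -!(big_mkord xpredT (fun k => (k`!)%:R^-1 *: iter k f x)) /=.
  rewrite (big_cat_nat _ lepq) //= [X in _ + X]big_nat_cond [X in _ + X]big1 ?addr0 //.
  move=> k /andP[/andP[lepk _] _].
  by rewrite -(subnK lepk) iterD fp0 iter_raddf0 scaler0.
move=> fm0; have fd0 : iter (\dim {:E}).+1 f x = 0 by rewrite iterS (iter_nilp fm0) raddf0.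
rewrite /nilp_exp; have [/shrink->//|/ltnW/shrink->//] := leqP m (\dim {:E}).+1.
Qed.

End NilpotentExponential.

Section TensorOperators.
Variables (K : fieldType) (n : nat) (P : finType).
Implicit Types (g h N : P -> 'M[K]_n) (t : tensor K n P) (A : {set P}).

Lemma tensor_grp_mul g h t :
  tensor_grp g (tensor_grp h t) = tensor_grp (fun p => g p *m h p) t.
Proof.
apply/ffunP=> tau; rewrite !ffunE.
under eq_bigr => s _ do rewrite ffunE mulr_sumr.
rewrite exchange_big; apply: eq_bigr=> s _ /=.
under eq_bigr => s' _ do rewrite mulrA -big_split.
rewrite -mulr_suml; congr (_ * _).
rewrite -(bigA_distr_bigA (fun p i => g p (tau p) i * h p i (s p))) /=.
by apply: eq_bigr=> p _; rewrite mxE.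
Qed.

Lemma eq_tensor_grp g h t : g =1 h -> tensor_grp g t = tensor_grp h t.
Proof.
move=> e; apply/ffunP=> tau; rewrite !ffunE; apply: eq_bigr=> s _.
by congr (_ * _); apply: eq_bigr=> p _; rewrite e.
Qed.

Lemma tensor_grp_eq0 g t p : g p = 0 -> tensor_grp g t = 0.
Proof.
move=> gp; apply/ffunP=> tau; rewrite !ffunE big1 // => s _.
by rewrite (bigD1 p) //= gp mxE !mul0r.
Qed.

Lemma tensor_grp_linear g : linear (tensor_grp g).
Proof.
move=> a t u; apply/ffunP=> tau; rewrite !ffunE scaler_sumr -big_split /=.
by apply: eq_bigr=> s _; rewrite !ffunE mulrDr scalerAr.
Qed.

HB.instance Definition _ g :=
  GRing.isLinear.Build K (tensor K n P) (tensor K n P) _ (tensor_grp g) (tensor_grp_linear g).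

(* The operators [N p], p in A, applied simultaneously; the k-th power of [tensor_lie N] is
   k! times the sum of these over the sets A of size k when the [N p] have square zero. *)
Definition partial_op N A t := tensor_grp (fun p => if p \in A then N p else 1%:M) t.

Lemma partial_op_linear N A : linear (partial_op N A).
Proof. exact: tensor_grp_linear. Qed.

HB.instance Definition _ N A := GRing.isLinear.Build K (tensor K n P) (tensor K n P) _
  (partial_op N A) (partial_op_linear N A).

Lemma tensor_lieE N t : tensor_lie N t = \sum_p partial_op N [set p] t.
Proof.
apply/ffunP=> tau; rewrite ffunE sum_ffunE; apply: eq_bigr=> p _.
(* The identity matrices in the slots other than [p] leave only the [s] that agree with [tau]
   there. *)
rewrite ffunE (bigID (fun s : {ffun P -> 'I_n} => s == set_at tau p (s p))) /=.
rewrite [X in _ + X]big1 ?addr0 => [|s /eqP sne].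
  rewrite (reindex (set_at tau p)) /=; last first.
    exists (fun s : {ffun P -> 'I_n} => s p) => [a _|s /eqP<- //].
    by rewrite ffunE eqxx.
  apply: eq_big => [a|a _]; first by rewrite ffunE !eqxx.
  congr (_ * _); rewrite (bigD1 p) //= in_set1 !eqxx ffunE eqxx.
  rewrite big1 ?mulr1 // => q qp.
  by rewrite in_set1 (negbTE qp) ffunE (negbTE qp) mxE eqxx.
have [q qp sq] : exists2 q, q != p & s q != tau q.
  apply: contra_notP sne => H; apply/ffunP=> q; rewrite ffunE.
  by have [->//|qp] := eqVneq q p; apply/eqP; apply/negPn/negP=> sq; case: H; exists q.
by rewrite (bigD1 q) //= in_set1 (negbTE qp) mxE eq_sym (negbTE sq) !mul0r.
Qed.

Lemma tensor_lie_linear N : linear (tensor_lie N).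
Proof.
move=> a t u; rewrite !tensor_lieE scaler_sumr -big_split /=.
by apply: eq_bigr=> p _; rewrite linearP.
Qed.

HB.instance Definition _ N :=
  GRing.isLinear.Build K (tensor K n P) (tensor K n P) _ (tensor_lie N) (tensor_lie_linear N).

Lemma partial_op_step N A p t : (forall q, N q *m N q = 0) ->
  partial_op N [set p] (partial_op N A t) =
  if p \in A then 0 else partial_op N (p |: A) t.
Proof.
move=> N2; rewrite /partial_op tensor_grp_mul; case: ifPn => pA.
  by apply: (tensor_grp_eq0 _ (p := p)); rewrite in_set1 eqxx pA.
apply: eq_tensor_grp => q; rewrite !inE; have [->|_] := eqVneq q p.
  by rewrite (negbTE pA) mulmx1.
by rewrite mul1mx.
Qed.

(** Applying one more [N p] adds [p] to the set [A], or gives 0 if [p] is already there. A set of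
    size [k.+1] arises in [k.+1] ways, one for each of its elements, which accounts for the
    factorial. *)
Lemma iter_tensor_lie N k t : (forall p, N p *m N p = 0) ->
  iter k (tensor_lie N) t = (k`!)%:R *: \sum_(A : {set P} | #|A| == k) partial_op N A t.
Proof.
move=> N2; elim: k => [|k IH].
  rewrite /= scale1r (eq_bigl (pred1 set0)) => [|A]; last by rewrite /= cards_eq0.
  rewrite big_pred1_eq /partial_op (eq_tensor_grp (h := fun=> 1%:M)) => [|p]; last by rewrite inE.
  apply/ffunP=> tau; rewrite ffunE (bigD1 tau) //= big1 => [|p _]; last by rewrite mxE eqxx.
  rewrite mul1r big1 ?addr0 // => s /eqP sne.
  have /existsP[p sp] : [exists p, tau p != s p].
    by apply: contra_notT sne; rewrite negb_exists => /forallP H; apply/ffunP=> p; apply/esym/eqP/negPn/H.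
  by rewrite (bigD1 p) //= mxE (negbTE sp) !mul0r.
rewrite iterS IH linearZ factS mulnC natrM -scalerA; congr (_ *: _); rewrite /=.
rewrite tensor_lieE.
under [LHS]eq_bigr => p _ do rewrite linear_sum.
under [LHS] eq_bigr => p _ do under eq_bigr => A _ do rewrite /= partial_op_step //.
transitivity (\sum_p \sum_(B : {set P} | (#|B| == k.+1) && (p \in B)) partial_op N B t).
  apply: eq_bigr=> p _; rewrite (bigID (fun A : {set P} => p \in A)) /=.
  rewrite big1 ?add0r => [|A /andP[_ ->] //].
  rewrite (reindex_onto (fun B : {set P} => B :\ p) (fun A => p |: A)) /=; last first.
    by move=> A /andP[_ pA]; rewrite setU1K.
  apply: eq_big => [B|B /andP[/andP[_ /negbTE->] /eqP-> //]].
  rewrite !inE eqxx /= andbT; have [pB|pB] := boolP (p \in B).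
    by rewrite setD1K // eqxx !andbT (cardsD1 p B) pB add1n eqSS.
  rewrite andbF; apply/negbTE; rewrite negb_and; apply/orP; right.
  by apply: contra pB => /eqP<-; rewrite !inE eqxx.
rewrite (exchange_big_dep (fun B : {set P} => #|B| == k.+1)) /=; last by move=> p B _ /andP[].
rewrite scaler_sumr; apply: eq_bigr=> B /eqP cB.
by rewrite (eq_bigl (mem B)) => [|p]; rewrite ?cB ?eqxx // sumr_const cB scaler_nat.
Qed.

Lemma iter_tensor_lie_nilp N t : (forall p, N p *m N p = 0) ->
  iter #|P|.+1 (tensor_lie N) t = 0.
Proof.
move=> N2; rewrite iter_tensor_lie // big1 ?scaler0 // => A /eqP cA.
by have := max_card (mem A); rewrite cA ltnn.
Qed.

(** In characteristic 0 the factorials cancel, and the sum of [partial_op N A] over all sets [A] is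
    the expansion of the tensor product of the operators [1%:M + N p]. *)
Lemma sum_iter_tensor_lie N t : [pchar K] =i pred0 -> (forall p, N p *m N p = 0) ->
  \sum_(k < #|P|.+1) (k`!)%:R^-1 *: iter k (tensor_lie N) t =
  tensor_grp (fun p => 1%:M + N p) t.
Proof.
move=> char0 N2; under eq_bigr => k _.
  rewrite iter_tensor_lie // scalerA mulVf ?scale1r; first over.
  by have /pcharf0P-> := char0; rewrite -lt0n fact_gt0.
transitivity (\sum_(A : {set P}) partial_op N A t).
  rewrite [RHS](partition_big (fun A : {set P} => inord #|A| : 'I_#|P|.+1) xpredT) //=.
  apply: eq_bigr=> k _; apply: eq_bigl=> A.
  by rewrite -val_eqE /= inordK // ltnS max_card.
apply/ffunP=> tau; rewrite sum_ffunE ffunE.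
under eq_bigr => A _ do rewrite ffunE.
rewrite exchange_big; apply: eq_bigr=> s _ /=; rewrite -mulr_suml; congr (_ * _).
rewrite (eq_bigr (fun p => N p (tau p) (s p) + (1%:M : 'M[K]_n) (tau p) (s p))); last first.
  by move=> p _; rewrite mxE addrC.
rewrite bigA_distr; apply: eq_bigr=> A _; apply: eq_bigr=> p _.
by case: ifP.
Qed.

Lemma nilp_exp_tensor_lie N t : [pchar K] =i pred0 -> (forall p, N p *m N p = 0) ->
  nilp_exp (tensor_lie N) t = tensor_grp (fun p => 1%:M + N p) t.
Proof.
by move=> char0 N2; rewrite -sum_iter_tensor_lie // (nilp_expE (iter_tensor_lie_nilp _ N2)).
Qed.

End TensorOperators.

(** * Segre coordinates *)

Section SegreMap.
Variables (K : fieldType) (n s : nat) (d : 'I_s -> nat).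
Local Notation slots := (slots d).

Definition slot (l : 'I_s) (k : 'I_(d l)) : slots := Tagged (fun i => 'I_(d i)) k.

Definition restrict (tau : {ffun slots -> 'I_n}) (l : 'I_s) : {ffun 'I_(d l) -> 'I_n} :=
  [ffun k => tau (slot k)].

Definition glue (f : forall l, 'I_(d l) -> 'I_n) : {ffun slots -> 'I_n} :=
  [ffun p : slots => f (tag p) (tagged p)].

Lemma restrict_glue f l : restrict (glue f) l = finfun (f l).
Proof. by apply/ffunP=> k; rewrite !ffunE. Qed.

Lemma restrict_set_at tau l k a :
  restrict (set_at tau (@slot l k) a) l = set_at (restrict tau l) k a.
Proof. by apply/ffunP=> j; rewrite !ffunE eq_Tagged. Qed.

Lemma restrict_set_at_neq tau l l' k a : l' != l ->
  restrict (set_at tau (@slot l k) a) l' = restrict tau l'.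
Proof.
move=> ll'; apply/ffunP=> j; rewrite !ffunE ifN //.
by apply: contra ll' => /eqP/(congr1 tag)/= ->.
Qed.

Lemma SegreE (t : forall l, tensor K n 'I_(d l)) tau :
  Segre t tau = \prod_l t l (restrict tau l).
Proof. by rewrite ffunE. Qed.

Lemma prod_slots (F : slots -> K) : \prod_p F p = \prod_l \prod_k F (@slot l k).
Proof. by rewrite sig_big_dep; apply: eq_bigr=> -[]. Qed.

Lemma sum_glue (F : {ffun slots -> 'I_n} -> K) :
  \sum_sg F sg = \sum_(f : fprod (fun l => {ffun 'I_(d l) -> 'I_n})) F (glue (fun l => f l)).
Proof.
rewrite (reindex (fun f : fprod (fun l => {ffun 'I_(d l) -> 'I_n}) => glue (fun l => f l))) //=.
exists (fun sg => fprod_of_fun (restrict sg)) => [f _|sg _].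
  by apply/fprodP=> l; rewrite fprodE restrict_glue; apply/ffunP=> k; rewrite ffunE.
by apply/ffunP=> -[l k]; rewrite !ffunE fprodE ffunE.
Qed.

(** A sum over index functions on [slots] is a sum over families of index functions, so
    distributivity turns it into a product of sums, one for each factor. *)
Lemma tensor_grp_Segre (g : 'I_s -> 'M[K]_n) (t : forall l, tensor K n 'I_(d l)) :
  tensor_grp (fun p : slots => g (tag p)) (Segre t) =
  Segre (fun l => tensor_grp (fun=> g l) (t l)).
Proof.
apply/ffunP=> tau; rewrite SegreE ffunE sum_glue.
pose F l : {ffun {ffun 'I_(d l) -> 'I_n} -> K} := [ffun f : {ffun 'I_(d l) -> 'I_n} =>
  (\prod_k g l (restrict tau l k) (f k)) * t l f].
transitivity (\prod_l \sum_f F l f); last first.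
  by apply: eq_bigr=> l _; rewrite ffunE; apply: eq_bigr=> f _; rewrite ffunE.
under [RHS]eq_bigr => l _ do
  rewrite (big_tag (fun l (f : {ffun 'I_(d l) -> 'I_n}) => F l f)).
rewrite bigA_distr_big_dep.
transitivity (\sum_(f : fprod (fun l => {ffun 'I_(d l) -> 'I_n})) \prod_l F l (f l)); last first.
  exact: (@big_fprod K 0 1 *%R +%R).
apply: eq_bigr=> f _; rewrite SegreE prod_slots -big_split /=.
apply: eq_bigr=> l _; rewrite ffunE restrict_glue; congr (_ * t l _).
  by apply: eq_bigr=> k _; rewrite !ffunE.
by apply/ffunP=> k; rewrite ffunE.
Qed.

Definition Segre_wedge (A : forall l, 'M[K]_(n, d l)) : tensor K n slots :=
  Segre (fun l => wedge_mx (A l)).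

Lemma Segre_wedgeE A tau : Segre_wedge A tau = \prod_l \det (rowsub (restrict tau l) (A l)).
Proof. by rewrite SegreE; apply: eq_bigr=> l _; rewrite wedge_mxE. Qed.

Lemma eq_Segre (t u : forall l, tensor K n 'I_(d l)) : (forall l, t l = u l) -> Segre t = Segre u.
Proof. by move=> e; apply/ffunP=> tau; rewrite !SegreE; apply: eq_bigr=> l _; rewrite e. Qed.

Lemma segre_plueckerP (U : Defs.family K n s) (t : tensor K n slots) :
  segre_pluecker U t <->
  exists A : forall l, 'M[K]_(n, d l),
    [/\ forall l, row_full (A l), forall l, U l = colsp (A l) & t = Segre_wedge A].
Proof.
split=> [[p pU ->]|[A [fA UA ->]]]; last first.
  by exists (fun l => wedge_mx (A l)) => // l; rewrite UA; exact: pluecker_wedge_mx.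
have H l : exists A : 'M[K]_(n, d l), [/\ row_full A, U l = colsp A & p l = wedge_mx A].
  exact/plueckerP.
pose A l := projT1 (cid (H l)); exists A; rewrite /A.
split=> [l|l|]; try by case: (cid (H l)) => B [].
by apply: eq_Segre => l; case: (cid (H l)) => B [].
Qed.

Lemma Segre_wedge_neq0 (A : forall l, 'M[K]_(n, d l)) : (forall l, row_full (A l)) ->
  exists2 tau : {ffun slots -> 'I_n}, Segre_wedge A tau != 0 &
    forall l, rowsub (restrict tau l) (A l) \in unitmx.
Proof.
move=> fA; pose f l := projT1 (cid (row_full_minor (fA l))).
have fP l : rowsub (f l) (A l) \in unitmx by rewrite /f; case: cid.
exists (glue (fun l => f l)).
  rewrite Segre_wedgeE; apply/prodf_neq0=> l _; rewrite -unitfE -unitmxE restrict_glue.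
  by rewrite ffunK.
by move=> l; rewrite restrict_glue ffunK.
Qed.

Lemma Segre_wedge_set_at (A : forall l, 'M[K]_(n, d l)) tau l (k : 'I_(d l)) i :
  Segre_wedge A (set_at tau (slot k) i) =
  (A l *m \adj (rowsub (restrict tau l) (A l))) i k *
  \prod_(m | m != l) \det (rowsub (restrict tau m) (A m)).
Proof.
rewrite SegreE (bigD1 l) //= restrict_set_at wedge_mx_set_at; congr (_ * _).
by apply: eq_bigr=> m ml; rewrite restrict_set_at_neq // wedge_mxE.
Qed.

(** Where the coordinate at [tau] is nonzero, replacing one index of [tau] reads off the basis
    normalized to the identity on the rows chosen by [tau]. *)
Lemma Segre_wedge_chart (A : forall l, 'M[K]_(n, d l)) tau l (k : 'I_(d l)) i :
  Segre_wedge A tau != 0 ->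
  Segre_wedge A (set_at tau (slot k) i) / Segre_wedge A tau =
  (A l *m invmx (rowsub (restrict tau l) (A l))) i k.
Proof.
rewrite Segre_wedge_set_at Segre_wedgeE (bigD1 l) //= mulf_eq0 negb_or => /andP[u v].
rewrite -mulf_div divff // mulr1 /invmx unitmxE unitfE u -scalemxAr [RHS]mxE.
by rewrite mulrC.
Qed.

End SegreMap.

(** * The orbit of the highest weight line *)

Section CoordinateProjections.
Variables (K : fieldType) (n : nat).
Implicit Types (S T : {set 'I_n}).

Definition cproj S : 'M[K]_n := \matrix_(i, j) ((i == j) && (i \in S))%:R.

Lemma cproj_mulE m S (A : 'M[K]_(n, m)) i j :
  (cproj S *m A) i j = if i \in S then A i j else 0.
Proof.
rewrite mxE (bigD1 i) //= mxE eqxx /= big1 ?addr0 => [|k ki].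
  by case: ifP; rewrite ?mul1r ?mul0r.
by rewrite mxE eq_sym (negbTE ki) mul0r.
Qed.

Lemma mul_cprojE m S (A : 'M[K]_(m, n)) i j :
  (A *m cproj S) i j = if j \in S then A i j else 0.
Proof.
rewrite mxE (bigD1 j) //= mxE eqxx /= big1 ?addr0 => [|k kj].
  by case: ifP; rewrite ?mulr1 ?mulr0.
by rewrite mxE (negbTE kj) mulr0.
Qed.

Lemma cprojE S i j : cproj S i j = if i \in S then (i == j)%:R else 0.
Proof. by rewrite mxE; case: ifP; rewrite ?andbT ?andbF. Qed.

Lemma cprojM S T : cproj S *m cproj T = cproj (S :&: T).
Proof.
apply/matrixP=> i j; rewrite cproj_mulE !mxE inE.
by case: ifP; rewrite ?andbF.
Qed.

Lemma cprojM_sub S T : S \subset T -> cproj S *m cproj T = cproj S.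
Proof. by rewrite cprojM => /setIidPl->. Qed.

Lemma cprojM_subr S T : S \subset T -> cproj T *m cproj S = cproj S.
Proof. by rewrite cprojM => /setIidPr->. Qed.

Lemma cprojM_disjoint S T : [disjoint S & T] -> cproj S *m cproj T = 0.
Proof.
rewrite cprojM -setI_eq0 => /eqP->.
by apply/matrixP=> i j; rewrite !mxE inE andbF.
Qed.

Lemma cproj_idem S : cproj S *m cproj S = cproj S.
Proof. exact: cprojM_sub. Qed.

Definition low (d : nat) : {set 'I_n} := [set j : 'I_n | (j < d)%N].
Definition gap (a b : nat) : {set 'I_n} := [set j : 'I_n | (a <= j < b)%N].

(* Kills [v_(a+1), ..., v_b] in the numbering starting at 1. *)
Definition kill (a b : nat) : 'M[K]_n := cproj (~: gap a b).

Definition hw_mx (d : nat) : 'M[K]_(n, d) := \matrix_(i, k) (i == k :> nat)%:R.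

Lemma wedge_hwE d : wedge_hw K n d = wedge_mx (hw_mx d).
Proof.
by rewrite /wedge_hw wedgeE; congr wedge_mx; apply/matrixP=> i k; rewrite !mxE.
Qed.

Lemma degen_lowerE d (y : 'M[K]_n) i j : strict_lower y ->
  degen d y i j = if (j < d <= i)%N then y i j else 0.
Proof.
move=> yl; rewrite mxE; have [ij|ij] := leqP i j; last by [].
rewrite [if (j < d <= i)%N then _ else _]ifN; last first.
  by apply/negP=> /andP[jd di]; have := leq_trans (leq_ltn_trans ij jd) di; rewrite ltnn.
by case: ifP => // _; have := yl j i ij; rewrite mxE.
Qed.

(** [degen d y] sends the first [d] basis vectors to the span of the others, which it kills. *)
Lemma degen_lower_sqr d (y : 'M[K]_n) : strict_lower y -> degen d y *m degen d y = 0.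
Proof.
move=> yl; apply/matrixP=> i j; rewrite !mxE big1 // => k _; rewrite !degen_lowerE //.
case: ifP => [/andP[kd _]|_]; last by rewrite mul0r.
by rewrite [X in _ * X]ifN ?mulr0 // negb_and -!ltnNge kd orbT.
Qed.

End CoordinateProjections.

Arguments gap {n} a b.
Arguments low {n} d.

Lemma Segre_orbit (K : fieldType) n s (d : 'I_s -> nat) (y : 'M[K]_n) :
  [pchar K] =i pred0 -> strict_lower y ->
  tensor_grp (fun p : slots d => 1%:M + degen (d (tag p)) y)
    (Segre (fun l => wedge_hw K n (d l))) =
  Segre_wedge (fun l => (1%:M + degen (d l) y) *m hw_mx K n (d l)).
Proof.
move=> c0 yl; rewrite (tensor_grp_Segre (fun l => 1%:M + degen (d l) y)).
by apply: eq_Segre => l; rewrite wedge_hwE tensor_grp_wedge.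
Qed.

Section ConeOfOrbit.
Variables (K : fieldType) (n s : nat) (d : 'I_s -> nat) (W : vectType K).
Variables (act : {linear 'M[K]_n -> 'End(W)}) (v : W).
Variables (iota : {linear W -> tensor K n (slots d)}).
Hypotheses (char0 : [pchar K] =i pred0) (emb : cartan_embedding act v iota).

Lemma strict_lower_sl (y : 'M[K]_n) : strict_lower y -> in_sl y.
Proof. by move=> yl; rewrite /in_sl /mxtrace big1 // => i _; have := yl i i (leqnn _); rewrite mxE. Qed.

(** Equivariance carries the powers of [act y] to those of the operator on tensors, which is
    nilpotent. Injectivity of [iota] gives nilpotency at [v], and the exponential is then computed
    on tensors. *)
Lemma iota_orbit y : strict_lower y ->
  iota (nilp_exp (act y) v) = Segre_wedge (fun l => (1%:M + degen (d l) y) *m hw_mx K n (d l)).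
Proof.
move=> yl; have N2 p : degen (d (tag p)) y *m degen (d (tag p)) y = 0 by exact: degen_lower_sqr.
have iterE k : iota (iter k (act y) v) =
    iter k (tensor_lie (fun p : slots d => degen (d (tag p)) y)) (iota v).
  elim: k => [//|k IH]; rewrite !iterS -IH; exact/(iota_equiv emb)/strict_lower_sl.
have nilp : iter #|slots d|.+1 (act y) v = 0.
  by apply: (iota_inj emb); rewrite iterE iter_tensor_lie_nilp // raddf0.
rewrite (nilp_expE nilp) linear_sum -Segre_orbit // -(iota_hw emb).
by rewrite -sum_iter_tensor_lie //; apply: eq_bigr=> k _; rewrite linearZ iterE.
Qed.

End ConeOfOrbit.

Section LinearForms.
Variables (K : fieldType) (E : vectType K) (f : E -> K).
Hypothesis f_lin : linear (f : E -> K^o).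

Lemma linear_form_coord x : f x = \sum_i coord (vbasis {:E}) i x * f (vbasis {:E})`_i.
Proof.
pose L := GRing.isLinear.Build _ _ _ _ _ f_lin.
pose g : {linear E -> K^o} := HB.pack (f : E -> K^o) L.
rewrite -[LHS]/(g x) {1}(coord_vbasis (memvf x)) linear_sum.
by apply: eq_bigr=> i _; rewrite linearZ.
Qed.

(** A linear form is a homogeneous polynomial of degree 1 in the coordinates, so it may be used to
    test the closure. *)
Lemma proj_closure_linear (S : E -> Prop) x :
  (forall y, S y -> f y = 0) -> proj_closure S x -> f x = 0.
Proof.
move=> fS [_ /(_ 1%N (\sum_(i < \dim {:E}) f (vbasis {:E})`_i *: 'X_i))].
have pE z : (\sum_(i < \dim {:E}) f (vbasis {:E})`_i *: 'X_i).@[fun i => coord (vbasis {:E}) i z] = f z.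
  rewrite linear_sum linear_form_coord; apply: eq_bigr=> i _ /=.
  by rewrite mevalZ mevalXU mulrC.
rewrite pE; apply=> [|y /fS]; last by rewrite pE.
by apply: rpred_sum=> i _; apply: dhomogZ; rewrite dhomogX /= mdeg1.
Qed.

End LinearForms.

Lemma succ_ord_neq s (l l' : 'I_s) : l' = l.+1 :> nat -> l' != l.
Proof. by move=> e; apply/eqP=> /(congr1 val)/= /eqP; rewrite e gtn_eqF. Qed.

(** * Incidence as linear equations in Segre coordinates *)

Section Incidence.
Variables (K : fieldType) (n s : nat) (d : 'I_s -> nat).

Definition incident (U : Defs.family K n s) : Prop :=
  (forall l, \dim (U l) = d l) /\
  (forall l l' : 'I_s, l' = l.+1 :> nat ->
     forall u, u \in U l -> kill K n (d l) (d l') *m u \in U l').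

Section ExchangeForm.
Variables (l l' : 'I_s) (ll' : l' != l) (D : {set 'I_n}).

(* Cramer's rule turns the condition that the projection of the column space of [A l] to the
   coordinates in D lie in the column space of [A l'] into these linear equations on
   [Segre_wedge A]. *)
Definition exchange (tau : {ffun slots d -> 'I_n}) (k : 'I_(d l)) (i : 'I_n)
    (t : tensor K n (slots d)) : K :=
  (if i \in D then t (set_at tau (slot k) i) else 0) -
  \sum_(m < d l') if tau (slot m) \in D
    then t (set_at (set_at tau (slot m) i) (slot k) (tau (slot m))) else 0.

Lemma exchange_linear tau k i : linear (exchange tau k i : tensor K n (slots d) -> K^o).
Proof.
move=> a t u; rewrite /exchange scalerBr scaler_sumr.
under eq_bigr => m _ do rewrite !ffunE.
rewrite addrACA -opprD -big_split /= !ffunE; congr (_ - _).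
  by case: ifP; rewrite // scaler0 addr0.
by apply: eq_bigr=> m _; case: ifP; rewrite // scaler0 addr0.
Qed.

(** If [B] is invertible, Cramer's rule puts the columns of [C] in the column space of [A l']
    exactly when the difference on the right vanishes. The remaining factors enter only through the
    product of their minors. *)
Lemma exchange_wedge (A : forall l, 'M[K]_(n, d l)) (tau : {ffun slots d -> 'I_n}) (k : 'I_(d l)) i :
  let C := cproj K D *m (A l *m \adj (rowsub (restrict tau l) (A l))) in
  let B := rowsub (restrict tau l') (A l') in
  exchange tau k i (Segre_wedge A) =
  (\prod_(m | (m != l) && (m != l')) \det (rowsub (restrict tau m) (A m))) *
  (\det B *: C - A l' *m \adj B *m rowsub (restrict tau l') C) i k.
Proof.
move=> C B; rewrite /exchange; set r := \prod_(m | _) _.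
have e1 a : Segre_wedge A (set_at tau (slot k) a) =
   (A l *m \adj (rowsub (restrict tau l) (A l))) a k * (\det B * r).
  by rewrite Segre_wedge_set_at (bigD1 l').
have e2 m : Segre_wedge A (set_at (set_at tau (slot m) i) (slot k) (tau (slot m))) =
   (A l *m \adj (rowsub (restrict tau l) (A l))) (tau (slot m)) k *
   ((A l' *m \adj B) i m * r).
  rewrite Segre_wedge_set_at (bigD1 l') //=.
  rewrite restrict_set_at_neq 1?eq_sym // restrict_set_at.
  rewrite -(wedge_mxE (A l')) wedge_mx_set_at; congr (_ * (_ * _)).
  by apply: eq_bigr=> p /andP[_ pl']; rewrite restrict_set_at_neq.
have subE (X Y : 'M[K]_(n, d l)) : (X - Y) i k = X i k - Y i k by rewrite !mxE.
have scE c (X : 'M[K]_(n, d l)) : (c *: X) i k = c * X i k by rewrite !mxE.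
rewrite e1 subE scE [(_ *m rowsub _ _) i k]mxE mulrBr.
congr (_ - _).
  by rewrite /C cproj_mulE; case: ifP => _; rewrite ?mulr0 //; ring.
rewrite mulr_sumr; apply: eq_bigr=> m _; rewrite e2.
rewrite [rowsub _ _ _ _]mxE /C cproj_mulE ffunE; case: ifP => _; rewrite ?mulr0 //; ring.
Qed.

Lemma exchange_eq0 (A : forall l, 'M[K]_(n, d l)) (tau : {ffun slots d -> 'I_n}) (k : 'I_(d l)) i (M : 'M_(d l', d l)) :
  cproj K D *m A l = A l' *m M -> exchange tau k i (Segre_wedge A) = 0.
Proof.
move=> AM; rewrite exchange_wedge mulmxA AM -[A l' *m M *m _]mulmxA rowsub_mulmx.
set B := rowsub _ (A l'); set Y := M *m _.
rewrite mulmxA -[A l' *m _ *m B]mulmxA mul_adj_mx mul_mx_scalar -scalemxAl subrr.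
by rewrite mxE mulr0.
Qed.

Lemma colsp_exchange (A : forall l, 'M[K]_(n, d l)) :
  (forall m, row_full (A m)) ->
  (forall tau k i, exchange tau k i (Segre_wedge A) = 0) ->
  forall u, u \in colsp (A l) -> cproj K D *m u \in colsp (A l').
Proof.
move=> fA ex0; have [tau _ uA] := Segre_wedge_neq0 fA.
set B := rowsub (restrict tau l') (A l'); set Al := rowsub (restrict tau l) (A l).
have dn0 m : \det (rowsub (restrict tau m) (A m)) != 0 by rewrite -unitfE -unitmxE.
set C := cproj K D *m (A l *m \adj Al).
have CE : \det B *: C = A l' *m \adj B *m rowsub (restrict tau l') C.
  apply/matrixP=> i k; apply/eqP; rewrite -subr_eq0; apply/eqP.
  have := ex0 tau k i; rewrite exchange_wedge => /eqP.
  rewrite mulf_eq0 (negbTE (_ : \prod_(m | _) _ != 0)) /=; last exact/prodf_neq0.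
  by move=> /eqP; rewrite !mxE.
move=> _ /colspP[y ->].
have -> : A l *m y = (\det Al)^-1 *: (A l *m \adj Al *m (Al *m y)).
  rewrite -!mulmxA [\adj Al *m _]mulmxA mul_adj_mx mul_scalar_mx -scalemxAr.
  by rewrite scalerA mulVf ?scale1r.
rewrite -scalemxAr memvZ // (mulmxA (cproj K D)) -/C.
rewrite -[C](scalerK (dn0 l')) -/B CE -!mulmxA -scalemxAl memvZ //.
by rewrite -!mulmxA mem_colsp.
Qed.

End ExchangeForm.

Lemma incident_colsp (U : Defs.family K n s) (A : forall l, 'M[K]_(n, d l)) :
  (forall l, row_full (A l)) -> (forall l, U l = colsp (A l)) ->
  (forall l l' : 'I_s, l' = l.+1 :> nat ->
    forall tau (k : 'I_(d l)) i,
      exchange l' (~: gap (d l) (d l')) tau k i (Segre_wedge A) = 0) ->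
  incident U.
Proof.
move=> fA UA ex; split=> [l|l l' ll' u]; first by rewrite UA dim_colsp.
rewrite !UA; apply: colsp_exchange => // [|tau k i]; last exact: ex.
exact: succ_ord_neq ll'.
Qed.

End Incidence.

(** Column [k] of the orbit matrix at level [a] is the basis vector [k] plus the entries [y i k]
    with [a <= i]. Killing the rows from [a] to [b - 1] leaves those with [b <= i], which is column
    [k] at level [b]. *)
Lemma kill_orbit (K : fieldType) n (a b : nat) (y : 'M[K]_n) : (a <= b)%N -> strict_lower y ->
  kill K n a b *m ((1%:M + degen a y) *m hw_mx K n a) =
  (1%:M + degen b y) *m hw_mx K n b *m (\matrix_(i, j) (i == j :> nat)%:R).
Proof.
move=> ab yl.
have hwE m (i : 'I_n) (k : 'I_m) : ((1%:M + degen m y) *m hw_mx K n m) i k =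
  (i == k :> nat)%:R + if (m <= i)%N then \sum_(j < n) y i j * (j == k :> nat)%:R else 0.
  rewrite mulmxDl mul1mx mxE [hw_mx _ _ _ _ _]mxE; congr (_ + _).
  rewrite mxE; case: ifP => mi; last first.
    by rewrite big1 // => j _; rewrite degen_lowerE // mi andbF mul0r.
  apply: eq_bigr=> j _; rewrite degen_lowerE // mi andbT !mxE.
  by have [->|_] := eqVneq (j : nat) k; rewrite ?mulr0 // ltn_ord.
apply/matrixP=> i k; rewrite cproj_mulE hwE // mxE.
rewrite [RHS](bigD1 (widen_ord ab k)) //= [X in _ = _ + X]big1 ?addr0; last first.
  move=> j /eqP jk; have {}jk : (j == k :> nat) = false.
    by apply/eqP=> e; apply/jk/val_inj.
  by rewrite [X in _ * X]mxE jk mulr0.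
rewrite hwE // [X in _ * X]mxE eqxx mulr1 !inE /=.
case: (leqP b i) => bi; rewrite ?andbF ?andbT /=; first by rewrite (leq_trans ab bi).
case: (leqP a i) => ai /=; rewrite ?addr0 //.
by rewrite gtn_eqF // (leq_trans _ ai).
Qed.

Lemma incident_degenerate_flag (K : fieldType) n s (d : 'I_s -> nat) (W : vectType K)
    (act : {linear 'M[K]_n -> 'End(W)}) (v : W) (iota : {linear W -> tensor K n (slots d)}) U :
  (forall l l' : 'I_s, l' = l.+1 :> nat -> (d l <= d l')%N) ->
  [pchar K] =i pred0 -> cartan_embedding act v iota ->
  degenerate_flag act v iota U -> incident d U.
Proof.
move=> dle c0 emb [w wcone /segre_plueckerP[A [fA UA tA]]].
apply: (incident_colsp fA UA) => l l' ll' tau k i; rewrite -tA.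
have llN := succ_ord_neq ll'.
apply: (proj_closure_linear (f := fun w => exchange l' _ tau k i (iota w)) _ _ wcone).
  by move=> a x z; rewrite linearP exchange_linear.
move=> _ [y yl ->]; rewrite (iota_orbit c0 emb yl).
exact: (exchange_eq0 llN _ _ _ (kill_orbit (dle _ _ ll') yl)).
Qed.

(** * Deforming incident families *)

Section KillLemmas.
Variables (K : fieldType) (n : nat).

Lemma kill_trans a b c : (a <= b)%N -> (b <= c)%N ->
  kill K n b c *m kill K n a b = kill K n a c.
Proof.
move=> ab bc; rewrite cprojM; congr cproj; apply/setP=> i; rewrite !inE.
case: (leqP a i) => ai; case: (leqP b i) => bi; case: (ltnP i c) => ic //=.
- by have := leq_trans bc ic; rewrite leqNgt bi.
- by have := leq_trans ab bi; rewrite leqNgt ai.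
Qed.

Lemma kill_id a : kill K n a a = 1%:M.
Proof.
apply/matrixP=> i j; rewrite cprojE !inE mxE.
by case: (leqP a i) => //= ->.
Qed.

Lemma low_kill a b : (a <= b)%N -> cproj K (low b) *m kill K n a b = cproj K (low a).
Proof.
move=> ab; rewrite cprojM; congr cproj; apply/setP=> i; rewrite !inE.
by case: (leqP a i) => ai /=; [case: ltnP|rewrite (leq_trans ai ab)].
Qed.

Lemma lowS a b : (a <= b)%N -> low a \subset (low b : {set 'I_n}).
Proof. by move=> ab; apply/subsetP=> i; rewrite !inE => ia; exact: leq_trans ab. Qed.

Lemma card_low a : (a <= n)%N -> #|(low a : {set 'I_n})| = a.
Proof.
move=> an; have -> : low a = [set widen_ord an k | k : 'I_a].
  apply/setP=> i; rewrite inE; apply/idP/imsetP=> [ia|[k _ ->]]; last exact: (ltn_ord k).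
  by exists (Ordinal ia) => //; apply: val_inj.
by rewrite card_imset ?card_ord // => i j /(congr1 val)/= /val_inj.
Qed.

Lemma dim_cproj (S : {set 'I_n}) : \dim (colsp (cproj K S)) = #|S|.
Proof.
pose A : 'M[K]_(n, #|S|) := \matrix_(i, k) (i == enum_val k)%:R.
have AE m (B : 'M_(#|S|, m)) k j : (A *m B) (enum_val k) j = B k j.
  rewrite mxE (bigD1 k) //= mxE eqxx mul1r big1 ?addr0 // => k' k'k.
  by rewrite mxE (inj_eq enum_val_inj) eq_sym (negbTE k'k) mul0r.
have fA : row_full A.
  apply/row_full_inj=> y Ay; apply/colP=> k.
  by rewrite -[LHS](AE _ y k) Ay !mxE.
rewrite -(dim_colsp fA); congr (\dim _).
have e1 : cproj K S *m A = A.
  apply/matrixP=> i k; rewrite cproj_mulE mxE; case: ifPn => // iS.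
  by case: eqP => // e; rewrite e enum_valP in iS.
have e2 : A *m (A^T *m cproj K S) = cproj K S.
  apply/matrixP=> i j; rewrite cprojE mulmxA mul_cprojE mxE.
  have [jS|jS] := boolP (j \in S); last by have [->|ij] := eqVneq i j; rewrite ?(negbTE jS) //; case: ifP.
  rewrite (bigD1 (enum_rank_in jS j)) //= big1 ?addr0 => [|k kj]; last first.
    rewrite !mxE; have [e|_] := eqVneq j (enum_val k); last by rewrite mulr0.
    by case/negP: kj; apply/eqP/enum_val_inj; rewrite enum_rankK_in.
  rewrite !mxE enum_rankK_in // eqxx mulr1; case: ifPn => // iS.
  by case: eqP => // e; rewrite e jS in iS.
exact: colsp_eqP e1 e2.
Qed.

(** Some coordinate of the complementary projection [\1 - projv V] is nonzero at [k]. *)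
Lemma functional_vspace (V : {vspace 'cV[K]_n}) k : k \notin V ->
  exists l : 'rV[K]_n, (forall x, x \in V -> l *m x = 0) /\ (l *m k) 0 0 != 0.
Proof.
move=> kV; pose f := (\1 - projv V)%VF.
have [i fi] : exists i, (f k) i 0 != 0.
  apply/existsP; apply: contraR kV; rewrite negb_exists => /forallP fk0.
  have : f k = 0 by apply/colP=> i; rewrite [RHS]mxE; apply/eqP/negPn/fk0.
  by rewrite add_lfunE opp_lfunE id_lfunE => /eqP; rewrite subr_eq0 => /eqP->; exact: memv_proj.
pose l := \row_j (f (delta_mx j 0)) i 0; exists l.
have lE x : (l *m x) 0 0 = (f x) i 0.
  rewrite [x in RHS](_ : x = \sum_j x j 0 *: delta_mx j 0); last first.
    by rewrite [LHS]matrix_sum_delta; apply: eq_bigr=> j _; rewrite big_ord1.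
  rewrite linear_sum summxE mxE; apply: eq_bigr=> j _.
  by rewrite linearZ !mxE mulrC.
split=> [x xV|]; last by rewrite lE.
apply/matrixP=> a b; rewrite !ord1 lE add_lfunE opp_lfunE id_lfunE projv_id //.
by rewrite subrr !mxE.
Qed.

End KillLemmas.

Section DeformationStep.
Variables (K : fieldType) (n S : nat) (D : nat -> nat) (U : nat -> {vspace 'cV[K]_n}).
Hypotheses (Dle : forall k, (k < S)%N -> (D k <= D k.+1)%N) (DS : D S = n).
Hypothesis dimU : forall k, (k <= S)%N -> \dim (U k) = D k.
Hypothesis incU : forall k u, (k < S)%N -> u \in U k -> kill K n (D k) (D k.+1) *m u \in U k.+1.

(** [P k] is the span of the first [D k] basis vectors, [W k] the image of [U k] in it, and [N k]
    the kernel, that is the intersection of [U k] with the span of the remaining basis vectors.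
    Transversality at [k] means [W k = P k]. *)
Let Pi k : 'M[K]_n := cproj K (low (D k)).
Let P k := colsp (Pi k).
Let W k := (mxlfun (Pi k) @: U k)%VS.
Let N k := (U k :&: lker (mxlfun (Pi k)))%VS.
Local Notation kl i j := (kill K n (D i) (D j)).

Lemma Dmono i j : (i <= j)%N -> (j <= S)%N -> (D i <= D j)%N.
Proof.
move=> ij; rewrite -(subnKC ij); elim: (j - i)%N => [|m IH]; first by rewrite addn0.
by rewrite addnS => lt; rewrite (leq_trans (IH (ltnW lt))) // Dle.
Qed.

Lemma Dlen i : (i <= S)%N -> (D i <= n)%N.
Proof. by move=> iS; rewrite -DS Dmono. Qed.

Lemma incU_trans i j u : (i <= j)%N -> (j <= S)%N -> u \in U i -> kl i j *m u \in U j.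
Proof.
move=> ij jS uU; move: jS; rewrite -(subnKC ij); elim: (j - i)%N => [|m IH].
  by rewrite addn0 kill_id mul1mx.
rewrite addnS => lt; have d1 : (D i <= D (i + m))%N by rewrite Dmono ?leq_addr 1?ltnW.
rewrite -(kill_trans _ _ d1 (Dle lt)).
by rewrite -mulmxA incU // IH // ltnW.
Qed.

Lemma WP k x : reflect (exists2 u, u \in U k & x = Pi k *m u) (x \in W k).
Proof.
by apply: (iffP memv_imgP) => -[u uU ->]; exists u; rewrite ?mxlfunE.
Qed.

Lemma PP k x : reflect (Pi k *m x = x) (x \in P k).
Proof.
apply: (iffP idP) => [/colspP[y ->]|<-]; last exact: mem_colsp.
by rewrite mulmxA cproj_idem.
Qed.

Lemma NP k x : reflect (x \in U k /\ Pi k *m x = 0) (x \in N k).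
Proof.
rewrite memv_cap memv_ker mxlfunE.
by apply: (iffP andP) => -[xU /eqP e].
Qed.

Lemma WsubP k : (W k <= P k)%VS.
Proof. by apply/subvP=> _ /WP[u _ ->]; exact: mem_colsp. Qed.

Lemma Pmono i j : (i <= j)%N -> (j <= S)%N -> (P i <= P j)%VS.
Proof.
move=> ij jS; apply/subvP=> x /PP <-; apply/PP.
by rewrite mulmxA cprojM_subr // lowS // Dmono.
Qed.

(** [kl i j] kills exactly the coordinates by which [Pi j] differs from [Pi i]. *)
Lemma Wmono i j : (i <= j)%N -> (j <= S)%N -> (W i <= W j)%VS.
Proof.
move=> ij jS; apply/subvP=> _ /WP[u uU ->]; apply/WP.
exists (kl i j *m u); first exact: incU_trans.
by rewrite mulmxA low_kill // Dmono.
Qed.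

Lemma dimP k : (k <= S)%N -> \dim (P k) = D k.
Proof. by move=> kS; rewrite dim_cproj card_low // Dlen. Qed.

Lemma dimNW k : (k <= S)%N -> (\dim (N k) + \dim (W k) = D k)%N.
Proof. by move=> kS; rewrite limg_ker_dim dimU. Qed.

(** The reverse inclusion always holds for [k < S], by [WsubP] and [Wmono]. *)
Let good k := (P k :&: W k.+1 <= W k)%VS.

(** Descending induction from [U S], which is the whole space: if [P k.+1] lies in [W k.+1], then so
    does [P k], and goodness puts it in [W k]. *)
Lemma all_good : (forall k, (k < S)%N -> good k) -> forall k, (k <= S)%N -> (P k <= W k)%VS.
Proof.
move=> allg.
have PS : (P S <= W S)%VS.
  have US : U S = fullv.
    by apply/eqP; rewrite eqEdim subvf dimU // DS dimvf /dim /= muln1.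
  by rewrite /P /colsp /W US.
have H m : (m <= S)%N -> (P (S - m) <= W (S - m))%VS.
  elim: m => [_|m IH mS]; first by rewrite subn0.
  have mS' : (S - m.+1 < S)%N by rewrite ltn_subrL (leq_trans _ mS).
  have e : (S - m.+1).+1 = (S - m)%N by rewrite -subSn.
  apply: subv_trans (allg _ mS'); rewrite subv_cap subvv e /=.
  by apply: subv_trans (IH (ltnW mS)); apply: Pmono; rewrite ?leq_subr // -e.
by move=> k kS; have := H _ (leq_subr k S); rewrite subKn.
Qed.

(* For [c <= j <= e] the subspace [U j] is moved by [u |-> u + t * l(u) x], where l is first
   composed with the projection to [U e]: the conditions on x let the map out of [U e] respect
   the deformation, those on l the map into [U c]. *)
Definition deformation_datum (c e : nat) (x : 'cV[K]_n) (l : 'rV[K]_n) : Prop :=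
  [/\ (c <= e < S)%N,
      x \in U e.+1 /\ kl c e.+1 *m x = x, Pi e *m x \notin W e,
      (forall c', c = c'.+1 -> forall u, u \in U c' -> l *m (kl c' e *m u) = 0) &
      exists2 k, k \in N e & (l *m k) 0 0 != 0].

(** Take [e] least among the bad indices and [c] least such that the image of [U c] contains [N e].
    Minimality of [e] leads to the vector [x], minimality of [c] to the form [l]. *)
Lemma deformation_exists : (exists k, (k < S)%N && ~~ good k) ->
  exists c e x l, deformation_datum c e x l.
Proof.
move=> ex; case: (ex_minnP ex) => e /andP[eS bad] emin.
have Ke : (N e <= mxlfun (kl e e) @: U e)%VS.
  apply/subvP=> k /NP[kU _]; apply/memv_imgP.
  by exists k => //; rewrite mxlfunE kill_id mul1mx.
have exc : exists c, (N e <= mxlfun (kl c e) @: U c)%VS by exists e.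
case: (ex_minnP exc) => c Kc cmin; have ce : (c <= e)%N by exact: cmin.
have eS' := ltnW eS; have cS := leq_trans ce eS'.
(* Since [Pi e *m kl c e = Pi c], preimages in [U c] of vectors of [N e] lie in [N c]. *)
have KcKe : (\dim (N e) <= \dim (N c))%N.
  have sub : (N e <= mxlfun (kl c e) @: N c)%VS.
    apply/subvP=> k kN; have /memv_imgP[u uU kE] := subvP Kc _ kN.
    apply/memv_imgP; exists u => //; apply/NP; split=> //.
    have /NP[_ <-] := kN; rewrite kE mxlfunE mulmxA low_kill //; exact: Dmono.
  rewrite (leq_trans (dimvS sub)) // -(limg_ker_dim (mxlfun (kl c e)) (N c)).
  exact: leq_addl.
(* All indices from [c] to [e - 1] are good, so the inclusion descends one step at a time from [W e]
   to [W c]. *)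
have PW : (P c :&: W e <= W c)%VS.
  have H m : (m <= e - c)%N -> (P c :&: W e <= W (e - m))%VS.
    elim: m => [|m IH] me; first by rewrite subn0 capvSr.
    have em : (e - m.+1).+1 = (e - m)%N by lia.
    have lt : (e - m.+1 < e)%N by lia.
    have /negPn g : ~~ ~~ good (e - m.+1).
      by apply/negP=> b; have := emin (e - m.+1)%N; rewrite b (ltn_trans lt eS) leqNgt lt => /(_ isT).
    apply: subv_trans g; rewrite subv_cap em IH 1?ltnW // andbT.
    by apply: subv_trans (capvSl _ _) _; apply: Pmono; lia.
  by have := H _ (leqnn _); rewrite subKn.
(* The sum has dimension at least [D c + \dim (W e) - \dim (W c)], which is
   [\dim (N c) + \dim (W e)], hence at least [\dim (N e) + \dim (W e) = D e]. *)
have PWe : (P c + W e)%VS = P e.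
  apply/eqP; rewrite eqEdim subv_add Pmono // WsubP /= dimP //.
  have := dimv_sum_cap (P c) (W e); rewrite dimP // => dsum.
  move: dsum KcKe (dimNW eS') (dimNW cS) (dimvS PW); clear.
  by move: (\dim _) (\dim _) (\dim _) (\dim _) (\dim _) (\dim _); lia.
(* Badness at [e] gives [p0]. Modulo [W e] it can be replaced by [p] in [P c], and a lift [z] of [p]
   to [U e.+1] serves as [x]. *)
have /subvPn[p0] := bad; rewrite memv_cap => /andP[p0P p0W] p0n.
move: p0P; rewrite -PWe => /memv_addP[p pP [w wW p0E]].
have pW : p \notin W e by apply: contra p0n => pW; rewrite p0E rpredD.
have /WP[z zU pE] : p \in W e.+1.
  rewrite -[p](addrK w) -p0E rpredB //; exact: (subvP (Wmono (leqnSn e) eS)).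
have Piz : Pi e *m z = p.
  have /PP pPe : p \in P e by exact: (subvP (Pmono ce eS')).
  by rewrite -pPe pE mulmxA cprojM_sub // lowS // Dmono.
(* The image in [U e] of the subspace preceding [U c], or 0 if [c = 0]. It misses some [k] of [N e]:
   by minimality of [c] in the first case, and in the second because [N e = 0] would make [e]
   good. *)
pose V0 := if c is c'.+1 then (mxlfun (kl c' e) @: U c')%VS else 0%VS.
have /subvPn[k kN kV0] : ~~ (N e <= V0)%VS.
  rewrite /V0; case: (c) cmin => [_|c' cmin]; last first.
    by apply/negP=> /cmin; rewrite ltnn.
  rewrite subv0 -dimv_eq0; apply: contra bad => /eqP N0.
  apply: subv_trans (capvSl _ _) _.
  have /eqP-> : W e == P e; last exact: subvv.
  rewrite eqEdim WsubP dimP // -(dimNW eS') N0 add0n; exact: leqnn.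
have [l [lV0 lk]] := functional_vspace kV0.
exists c, e, z, l; split; rewrite ?ce ?Piz //; last by exists k.
  split=> //; apply/matrixP=> i j; rewrite cproj_mulE !inE; case: ifPn => //.
  rewrite negbK => /andP[ci ie].
  have := congr1 (fun y : 'cV_n => y i 0) pE; rewrite (ord1 j) cproj_mulE inE ie => <-.
  by move/PP: pP => <-; rewrite /Pi cproj_mulE inE ltnNge ci.
move=> c' cE u uU; apply: lV0; rewrite /V0 cE; apply/memv_imgP.
by exists u; rewrite ?mxlfunE.
Qed.

Section Deformed.
Variables (c e : nat) (x : 'cV[K]_n) (l : 'rV[K]_n).
Hypothesis dat : deformation_datum c e x l.

Definition deform_form j : 'rV[K]_n := if (c <= j <= e)%N then l *m kl j e else 0.
Definition deform_mx (t : K) j : 'M[K]_n := 1%:M + t *: (x *m deform_form j).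

Lemma deform_mxE t j (u : 'cV[K]_n) :
  deform_mx t j *m u = u + (t * (deform_form j *m u) 0 0) *: x.
Proof.
rewrite mulmxDl mul1mx -scalemxAl -mulmxA {1}[deform_form j *m u]mx11_scalar.
by rewrite mul_mx_scalar scalerA.
Qed.

Lemma deform_id t j (u : 'cV[K]_n) : deform_form j *m u = 0 -> deform_mx t j *m u = u.
Proof. by move=> e0; rewrite deform_mxE e0 mxE mulr0 scale0r addr0. Qed.

Lemma deform_form_out j (u : 'cV[K]_n) : ~~ (c <= j <= e)%N -> deform_form j *m u = 0.
Proof. by move=> /negbTE jce; rewrite /deform_form jce mul0mx. Qed.

(** The coordinates of [x] from [D c] to [D e.+1 - 1] vanish, and both equations concern only
    these. *)
Lemma kill_datum j : (c <= j <= e)%N -> kl j j.+1 *m x = x /\ Pi e *m x = Pi j *m x.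
Proof.
case: dat => /andP[ce eS] [_ xK] _ _ _ /andP[cj je].
have xi (i : 'I_n) : (D c <= i < D e.+1)%N -> x i 0 = 0 :> K.
  by move=> ii; rewrite -xK cproj_mulE !inE ii.
have dcj : (D c <= D j)%N by rewrite Dmono // (leq_trans je) // ltnW.
have dje : (D j <= D e)%N by rewrite Dmono // ltnW.
have dee : (D e <= D e.+1)%N by exact: Dle.
have dj1 : (D j.+1 <= D e.+1)%N by rewrite Dmono.
split; apply/matrixP=> i o; rewrite (ord1 o) !cproj_mulE !inE.
  by case: ifPn => //; rewrite negbK => ii; rewrite xi //; lia.
by case: ltnP => ie; case: ltnP => ij //; rewrite xi //; lia.
Qed.

(** Otherwise [Pi j *m x] is a multiple of [Pi j *m u], so [Pi e *m x], which equals [Pi j *m x],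
    lies in [W j] and hence in [W e], against the choice of [x]. *)
Lemma deform_transversal t j u : t != 0 -> (j <= S)%N -> u \in U j ->
  Pi j *m (deform_mx t j *m u) = 0 -> deform_form j *m u = 0.
Proof.
move=> t0 jS uU; have [jce|jce _] := boolP (c <= j <= e)%N; last exact: deform_form_out.
case: (kill_datum jce) => _ xE.
rewrite deform_mxE mulmxDr -scalemxAr; set a := (_ *m u) 0 0 => e0.
have [a0|a0] := eqVneq a 0.
  by apply/matrixP=> p q; rewrite !ord1 [RHS]mxE.
case: (dat) => /andP[ce eS] _ + _ _; case/negP; rewrite xE.
case/andP: jce => cj je; apply: (subvP (Wmono je (ltnW eS))); apply/WP.
exists (- (t * a)^-1 *: u); first by rewrite memvZ.
rewrite -scalemxAr; apply: (scalerI (mulf_neq0 t0 a0)).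
rewrite scalerA mulrN mulfV ?mulf_neq0 // scaleN1r.
by apply/eqP; rewrite -addr_eq0 addrC e0.
Qed.

Lemma deform_inj t j u : t != 0 -> (j <= S)%N -> u \in U j -> deform_mx t j *m u = 0 -> u = 0.
Proof.
move=> t0 jS uU e0; rewrite -[LHS](deform_id t (j := j)) //.
by apply: (deform_transversal t0 jS uU); rewrite e0 mulmx0.
Qed.

(** From [c] to [e - 1] the deformation commutes with the projections, as these fix [x] and the form
    at [j] is the form at [j.+1] after projection. At [j = e] the multiple of [x] added lies in
    [U e.+1], which is not moved. At [j = c - 1] the form vanishes on the image of [U j]. *)
Lemma deform_incident t j u : (j < S)%N -> u \in U j ->
  kl j j.+1 *m (deform_mx t j *m u) \in (mxlfun (deform_mx t j.+1) @: U j.+1)%VS.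
Proof.
move=> jS uU; have kU := incU jS uU.
have img v w : v \in U j.+1 -> w = deform_mx t j.+1 *m v ->
    w \in (mxlfun (deform_mx t j.+1) @: U j.+1)%VS.
  by move=> vU ->; rewrite -mxlfunE memv_img.
case: (dat) => /andP[ce eS] [xU _] _ lc _.
have [jce|jce] := boolP (c <= j <= e)%N; last first.
  rewrite deform_id ?deform_form_out //; apply: img kU _; rewrite deform_id //.
  have [jce'|jce'] := boolP (c <= j.+1 <= e)%N; last exact: deform_form_out.
  have cj : c = j.+1 by lia.
  rewrite /deform_form jce' -cj -mulmxA (mulmxA (kl c e)) cj kill_trans ?Dle //.
    exact: lc.
  by rewrite Dmono // ?(ltnW eS) // -cj.
case: (kill_datum jce) => xE _.
rewrite deform_mxE mulmxDr -scalemxAr xE.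
have [je|je] := eqVneq j e.
  rewrite -je in xU; apply: (img (kl j j.+1 *m u + (t * (deform_form j *m u) 0 0) *: x)).
    by rewrite rpredD // memvZ.
  by rewrite deform_id // deform_form_out // je ltnn andbF.
apply: img kU _; rewrite deform_mxE; congr (_ + (_ * _ 0 0) *: _).
have jce' : (c <= j.+1 <= e)%N by lia.
rewrite /deform_form jce jce' -!mulmxA; congr (_ *m _).
by rewrite mulmxA kill_trans ?Dle // Dmono // ?(ltnW eS) //; lia.
Qed.

(** By [deform_transversal] a vector of the deformed space that [Pi j] kills has not been moved. *)
Lemma deform_kernel t j : t != 0 -> (j <= S)%N ->
  ((mxlfun (deform_mx t j) @: U j) :&: lker (mxlfun (Pi j)) <= N j)%VS.
Proof.
move=> t0 jS; apply/subvP=> w; rewrite memv_cap memv_ker mxlfunE => /andP[/memv_imgP[u uU ->] /eqP].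
rewrite mxlfunE => e0; have := deform_transversal t0 jS uU e0 => f0.
by move: e0; rewrite deform_id // => e0; apply/NP.
Qed.

(** A vector of the new kernel is an unmoved one on which [l] vanishes, whereas the datum provides a
    [k] in [N e] with [l *m k] nonzero. *)
Lemma deform_kernel_strict t : t != 0 ->
  ~~ (N e <= (mxlfun (deform_mx t e) @: U e) :&: lker (mxlfun (Pi e)))%VS.
Proof.
move=> t0; case: (dat) => /andP[ce eS] _ _ _ [k kN lk].
apply/negP=> /subvP/(_ _ kN); rewrite memv_cap memv_ker mxlfunE.
move=> /andP[/memv_imgP[u uU kE] /eqP]; rewrite kE mxlfunE => e0.
have f0 := deform_transversal t0 (ltnW eS) uU e0.
move: lk; rewrite kE mxlfunE (deform_id _ f0).
by move: f0; rewrite /deform_form ce leqnn kill_id mulmx1 => ->; rewrite mxE eqxx.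
Qed.

End Deformed.

End DeformationStep.

(** * Functions given by polynomials *)

Section PolynomialFunctions.
Variables (K : fieldType) (X : Type) (Q : (X -> K) -> Prop).
Hypotheses (QC : forall c, Q (fun=> c)) (QD : forall f g, Q f -> Q g -> Q (fun x => f x + g x))
  (QM : forall f g, Q f -> Q g -> Q (fun x => f x * g x)).

Lemma fun_sum (I : Type) (r : seq I) (P : pred I) (F : I -> X -> K) :
  (forall i, P i -> Q (F i)) -> Q (fun x => \sum_(i <- r | P i) F i x).
Proof.
move=> QF; elim: r => [|i r IH].
  by have -> : (fun x => \sum_(i <- [::] | P i) F i x) = (fun=> 0) by apply/funext=> x; rewrite big_nil.
have -> : (fun x => \sum_(i <- i :: r | P i) F i x) =
   (fun x => (if P i then F i x else 0) + \sum_(i <- r | P i) F i x).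
  by apply/funext=> x; rewrite big_cons; case: ifP; rewrite ?add0r.
by apply: QD => //; case: (boolP (P i)) => [/QF|_].
Qed.

Lemma fun_prod (I : Type) (r : seq I) (P : pred I) (F : I -> X -> K) :
  (forall i, P i -> Q (F i)) -> Q (fun x => \prod_(i <- r | P i) F i x).
Proof.
move=> QF; elim: r => [|i r IH].
  by have -> : (fun x => \prod_(i <- [::] | P i) F i x) = (fun=> 1) by apply/funext=> x; rewrite big_nil.
have -> : (fun x => \prod_(i <- i :: r | P i) F i x) =
   (fun x => (if P i then F i x else 1) * \prod_(i <- r | P i) F i x).
  by apply/funext=> x; rewrite big_cons; case: ifP; rewrite ?mul1r.
by apply: QM => //; case: (boolP (P i)) => [/QF|_].
Qed.

Lemma fun_det m (M : X -> 'M[K]_m) : (forall i j, Q (fun x => M x i j)) -> Q (fun x => \det (M x)).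
Proof.
move=> QF; apply: (@fun_sum _ _ _ (fun (s : 'S_m) x => (-1) ^+ s * \prod_i M x i (s i))) => s _.
by apply: QM => //; apply: (@fun_prod _ _ _ (fun i x => M x i (s i))).
Qed.

Lemma fun_mulmx m p q (A : X -> 'M[K]_(m, p)) (B : X -> 'M[K]_(p, q)) :
  (forall i j, Q (fun x => A x i j)) -> (forall i j, Q (fun x => B x i j)) ->
  forall i j, Q (fun x => (A x *m B x) i j).
Proof.
move=> QA QB i j.
have -> : (fun x => (A x *m B x) i j) = (fun x => \sum_k A x i k * B x k j).
  by apply/funext=> x; rewrite mxE.
by apply: fun_sum => k _; apply: QM.
Qed.

Lemma fun_meval m (p : {mpoly K[m]}) (F : 'I_m -> X -> K) :
  (forall i, Q (F i)) -> Q (fun x => p.@[fun i => F i x]).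
Proof.
move=> QF.
have -> : (fun x => p.@[fun i => F i x]) =
    (fun x => \sum_(a <- msupp p) p@_a * \prod_i \prod_(k < a i) F i x).
  apply/funext=> x; rewrite mevalE; apply: eq_bigr=> a _; congr (_ * _).
  by apply: eq_bigr=> i _; rewrite prodr_const card_ord.
by apply: fun_sum => a _; apply: QM => //; apply: fun_prod => i _; apply: fun_prod.
Qed.

Lemma fun_Segre_wedge n s (d : 'I_s -> nat) (A : forall l, X -> 'M[K]_(n, d l)) :
  (forall l i j, Q (fun x => A l x i j)) -> forall tau, Q (fun x => Segre_wedge (fun l => A l x) tau).
Proof.
move=> QA tau.
have -> : (fun x => Segre_wedge (fun l => A l x) tau) =
    (fun x => \prod_l \det (rowsub (restrict tau l) (A l x))).
  by apply/funext=> x; rewrite Segre_wedgeE.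
apply: fun_prod => l _; apply: fun_det => i j.
by have -> : (fun x => rowsub (restrict tau l) (A l x) i j) = (fun x => A l x (restrict tau l i) j)
  by apply/funext=> x; rewrite mxE.
Qed.

End PolynomialFunctions.

Section UnivariatePolynomialFunctions.
Variable K : numFieldType.

Definition poly_fun (f : K -> K) : Prop := exists q : {poly K}, forall x, f x = q.[x].

Lemma poly_funC c : poly_fun (fun=> c).
Proof. by exists c%:P => x; rewrite hornerC. Qed.

Lemma poly_funD f g : poly_fun f -> poly_fun g -> poly_fun (fun x => f x + g x).
Proof. by move=> [p pE] [q qE]; exists (p + q) => x; rewrite hornerD pE qE. Qed.

Lemma poly_funM f g : poly_fun f -> poly_fun g -> poly_fun (fun x => f x * g x).
Proof. by move=> [p pE] [q qE]; exists (p * q) => x; rewrite hornerM pE qE. Qed.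

Lemma poly_fun_id : poly_fun id.
Proof. by exists 'X => x; rewrite hornerX. Qed.

(** Otherwise [q] would have the [size q] distinct roots [1, 2, ...], one more than its degree. *)
Lemma poly_fun_eq0 f : poly_fun f -> (forall x, x != 0 -> f x = 0) -> f 0 = 0.
Proof.
move=> [q qE] f0; rewrite qE.
suff -> : q = 0 by rewrite horner0.
apply/eqP; apply: contraT => q0.
have := max_poly_roots (rs := [seq k.+1%:R | k <- iota 0 (size q)]) q0.
rewrite size_map size_iota ltnn; apply.
  by apply/allP=> _ /mapP[k _ ->]; rewrite /root -qE f0 // Num.Theory.pnatr_eq0.
rewrite map_inj_uniq ?iota_uniq // => i j /eqP.
by rewrite Num.Theory.eqr_nat => /eqP[].
Qed.

End UnivariatePolynomialFunctions.

(** * Reduced echelon bases *)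

Section ReducedMatrices.
Variables (K : fieldType) (n : nat).
Implicit Types (L : {set 'I_n}) (E : 'M[K]_n) (U : {vspace 'cV[K]_n}).

(* Such an E is the projection onto its column space along the span of the [v_i], [i \notin L];
   its columns in L form a basis in reduced echelon form. *)
Definition reduced L E : Prop := E *m cproj K L = E /\ cproj K L *m E = cproj K L.

Lemma reducedM L E E' : reduced L E -> reduced L E' -> E *m E' = E.
Proof. by move=> [EL LE] [E'L LE']; rewrite -EL -mulmxA LE'. Qed.

Lemma reduced_fix L E x : reduced L E -> x \in colsp E -> E *m x = x.
Proof. by move=> rE /colspP[y ->]; rewrite mulmxA (reducedM rE rE). Qed.

Lemma reduced_inj L E E' : reduced L E -> reduced L E' -> colsp E = colsp E' -> E = E'.
Proof.
move=> rE rE' eqE; rewrite -(reducedM rE rE').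
apply/matrixP=> i j; have := reduced_fix rE (x := col j E').
rewrite eqE col_colsp => /(_ isT)/matrixP/(_ i 0).
rewrite [RHS]mxE => <-; rewrite !mxE; apply: eq_bigr=> k _; by rewrite mxE.
Qed.

Lemma cproj_delta L j : j \in L -> cproj K L *m delta_mx j (0 : 'I_1) = delta_mx j 0.
Proof.
move=> jL; apply/matrixP=> i o; rewrite cproj_mulE !mxE.
by case: ifPn => // iL; case: eqP => // e; rewrite e jL in iL.
Qed.

Lemma reduced_entry L E i j : reduced L E -> i \in L -> j \in L -> E i j = (i == j)%:R.
Proof.
move=> [_ LE] iL jL; have := congr1 (fun M : 'M_n => M i j) LE.
by rewrite cproj_mulE iL => ->; rewrite cprojE iL.
Qed.

Lemma reduced_entry0 L E i j : reduced L E -> j \notin L -> E i j = 0.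
Proof. by move=> [<- _] jL; rewrite mul_cprojE (negbTE jL). Qed.

(** The condition on the kernel makes the columns span: for [x] in [U], the vector [x - E *m x] lies
    in [U] and is killed by [cproj K L]. *)
Lemma reduced_columns L U (u : 'I_n -> 'cV[K]_n) :
  (forall x, x \in U -> cproj K L *m x = 0 -> x = 0) ->
  (forall j, j \in L -> u j \in U /\ cproj K L *m u j = delta_mx j 0) ->
  let E := \matrix_(i, j) if j \in L then u j i 0 else 0 in
  reduced L E /\ colsp E = U.
Proof.
move=> kerU uU E.
have cE j : col j E = if j \in L then u j else 0.
  by apply/colP=> i; rewrite !mxE; case: ifP; rewrite // mxE.
have rE : reduced L E.
  split; apply/matrixP=> i j.
    by rewrite mul_cprojE; case: ifPn => // jL; rewrite mxE (negbTE jL).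
  rewrite cproj_mulE cprojE; case: ifP => // iL; rewrite mxE.
  have [jL|jL] := boolP (j \in L); last by case: eqP => // e; rewrite -e iL in jL.
  have [_ /colP/(_ i)] := uU j jL.
  by rewrite cproj_mulE iL => ->; rewrite mxE eqxx andbT.
split=> //; apply/eqP; rewrite eqEsubv; apply/andP; split; apply/subvP=> x.
  move=> /colspP[y ->].
  rewrite (_ : E *m y = \sum_j y j 0 *: col j E); last first.
    apply/colP=> i; rewrite summxE mxE; apply: eq_bigr=> j _.
    by rewrite !mxE mulrC.
  by apply: rpred_sum=> j _; rewrite cE rpredZ //; case: ifP => [/uU[]|]; rewrite ?rpred0.
move=> xU; have EU y : E *m y \in U.
  rewrite (_ : E *m y = \sum_j y j 0 *: col j E); last first.
    apply/colP=> i; rewrite summxE mxE; apply: eq_bigr=> j _.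
    by rewrite !mxE mulrC.
  by apply: rpred_sum=> j _; rewrite cE rpredZ //; case: ifP => [/uU[]|]; rewrite ?rpred0.
have /eqP : x - E *m x = 0.
  apply: kerU; first by rewrite rpredB.
  by rewrite mulmxBr mulmxA (proj2 rE) subrr.
by rewrite subr_eq0 => /eqP->; exact: mem_colsp.
Qed.

Lemma hw_mx_cproj d : (d <= n)%N -> hw_mx K n d *m (hw_mx K n d)^T = cproj K (low d).
Proof.
move=> dn; apply/matrixP=> i j; rewrite cprojE inE mxE; case: ltnP => id; last first.
  by rewrite big1 // => k _; rewrite !mxE gtn_eqF ?mul0r // (leq_trans _ id).
rewrite (bigD1 (Ordinal id)) //= big1 ?addr0 => [|k ki]; last first.
  rewrite !mxE; have [e|_] := eqVneq (i : nat) k; last by rewrite mul0r.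
  by case/eqP: ki; apply: val_inj.
by rewrite !mxE eqxx mul1r eq_sym.
Qed.

Lemma low_hw_mx d : cproj K (low d) *m hw_mx K n d = hw_mx K n d.
Proof.
apply/matrixP=> i k; rewrite cproj_mulE inE mxE; case: ifPn => //.
by rewrite -leqNgt => di; rewrite gtn_eqF // (leq_trans _ di).
Qed.

Lemma hw_mx_full d : (d <= n)%N -> (hw_mx K n d)^T *m hw_mx K n d = 1%:M.
Proof.
move=> dn; apply/matrixP=> i j; rewrite mxE (bigD1 (widen_ord dn i)) //= big1 ?addr0.
  by rewrite !mxE eqxx mul1r.
move=> k ki; rewrite !mxE; have [e|_] := eqVneq (k : nat) i; last by rewrite mul0r.
by case/eqP: ki; apply: val_inj.
Qed.

End ReducedMatrices.

Section NatIndexing.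
Variables (K : fieldType) (n s : nat) (d : 'I_s -> nat) (U : Defs.family K n s).

(* Continuing the family by the whole space lets the deformation step treat the last
   subspace like the others. *)
Definition dim_ext (k : nat) : nat := if insub k is Some l then d l else n.
Definition fam_ext (k : nat) : {vspace 'cV[K]_n} := if insub k is Some l then U l else fullv.

Lemma dim_ext_ord (l : 'I_s) : dim_ext l = d l.
Proof. by rewrite /dim_ext valK. Qed.

Lemma fam_ext_ord (l : 'I_s) : fam_ext l = U l.
Proof. by rewrite /fam_ext valK. Qed.

Lemma dim_ext_out : dim_ext s = n.
Proof. by rewrite /dim_ext insubF ?ltnn. Qed.

Lemma fam_ext_out : fam_ext s = fullv.
Proof. by rewrite /fam_ext insubF ?ltnn. Qed.

Hypotheses (d_len : forall l, (d l <= n)%N)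
  (d_le : forall l l' : 'I_s, l' = l.+1 :> nat -> (d l <= d l')%N).

Lemma dim_ext_le k : (k < s)%N -> (dim_ext k <= dim_ext k.+1)%N.
Proof.
move=> ks; rewrite -[k]/(nat_of_ord (Ordinal ks)) dim_ext_ord.
have := ks; rewrite leq_eqVlt => /orP[/eqP e|ks1]; first by rewrite e dim_ext_out.
by rewrite -[_.+1]/(nat_of_ord (Ordinal ks1)) dim_ext_ord; apply: d_le.
Qed.

Hypothesis incU : incident d U.

Lemma dim_fam_ext k : (k <= s)%N -> \dim (fam_ext k) = dim_ext k.
Proof.
rewrite leq_eqVlt => /orP[/eqP->|ks].
  by rewrite fam_ext_out dim_ext_out dimvf /dim /= muln1.
by rewrite -[k]/(nat_of_ord (Ordinal ks)) fam_ext_ord dim_ext_ord; case: incU.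
Qed.

Lemma incident_ext k u : (k < s)%N -> u \in fam_ext k ->
  kill K n (dim_ext k) (dim_ext k.+1) *m u \in fam_ext k.+1.
Proof.
move=> ks; have := ks; rewrite leq_eqVlt => /orP[/eqP e|ks1].
  by rewrite e fam_ext_out memvf.
rewrite -[k.+1]/(nat_of_ord (Ordinal ks1)) -[k]/(nat_of_ord (Ordinal ks)).
by rewrite !fam_ext_ord !dim_ext_ord; case: incU => _; apply.
Qed.

Lemma incident_trans (l l' : 'I_s) u : (l <= l')%N -> u \in U l ->
  kill K n (d l) (d l') *m u \in U l'.
Proof.
move=> ll' uU; rewrite -!dim_ext_ord -fam_ext_ord.
apply: (incU_trans dim_ext_le incident_ext ll' (ltnW (ltn_ord l'))).
by rewrite fam_ext_ord.
Qed.

Definition low_proj l := mxlfun (cproj K (low (d l)) : 'M_n).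

Definition defect (U' : Defs.family K n s) : nat := \sum_l \dim (U' l :&: lker (low_proj l)).

(** Either every index is good, which makes the family transversal, or the deformation at the first
    bad index applies. Its maps [G l] are injective on [U l], so dimensions persist, and the defect
    drops at the index [e]. *)
Lemma deform_family :
  (forall l, (limg (low_proj l) <= low_proj l @: U l)%VS) \/
  exists (x : 'cV[K]_n) (f : 'I_s -> 'rV[K]_n), forall t, t != 0 ->
    let G l := 1%:M + t *: (x *m f l) in
    let U' := [ffun l => (mxlfun (G l) @: U l)%VS] in
    [/\ forall l u, u \in U l -> G l *m u = 0 -> u = 0, incident d U' & (defect U' < defect U)%N].
Proof.
pose good k := (colsp (cproj K (low (dim_ext k))) :&:
  (mxlfun (cproj K (low (dim_ext k.+1))) @: fam_ext k.+1) <=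
  mxlfun (cproj K (low (dim_ext k))) @: fam_ext k)%VS.
have [ex|nex] := pselect (exists k, (k < s)%N && ~~ good k); last first.
  left=> l; have allg k : (k < s)%N -> good k.
    by move=> ks; apply/negPn/negP=> b; apply: nex; exists k; rewrite ks.
  have := all_good dim_ext_le dim_ext_out dim_fam_ext allg (ltnW (ltn_ord l)).
  by rewrite dim_ext_ord fam_ext_ord.
right; have [c [e [x [f dat]]]] := deformation_exists dim_ext_le dim_ext_out dim_fam_ext incident_ext ex.
exists x, (fun l => deform_form dim_ext c e f l) => t t0 G U'.
have GE l : G l = deform_mx dim_ext c e x f t l by [].
have ls (l : 'I_s) : (l <= s)%N := ltnW (ltn_ord l).
have G_inj l u : u \in U l -> G l *m u = 0 -> u = 0.
  move=> uU Gu; have := deform_inj dim_ext_le dim_ext_out incident_ext dat t0 (ls l) (u := u).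
  by rewrite fam_ext_ord; apply.
have U'K l : (U' l :&: lker (low_proj l) <= U l :&: lker (low_proj l))%VS.
  have := deform_kernel dim_ext_le dim_ext_out incident_ext dat t0 (ls l).
  by rewrite ffunE -GE fam_ext_ord dim_ext_ord.
split=> //.
  case: incU => dimU iU; split=> [l|l l' ll' u'].
    rewrite ffunE limg_dim_eq //; apply/eqP; rewrite -subv0; apply/subvP=> u.
    rewrite memv_cap memv_ker mxlfunE memv0 => /andP[uU /eqP Gu].
    by apply/eqP; exact: G_inj Gu.
  rewrite !ffunE => /memv_imgP[u uU ->]; rewrite mxlfunE !GE ll'.
  have := @deform_incident _ _ _ _ _ dim_ext_le dim_ext_out incident_ext _ _ _ _ dat t l u (ltn_ord l).
  by rewrite -ll' !dim_ext_ord !fam_ext_ord; apply.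
have es : (e < s)%N by case: dat => /andP[].
rewrite /defect (bigD1 (Ordinal es)) //= [X in (_ < X)%N](bigD1 (Ordinal es)) //=.
rewrite -addSn leq_add //; last by apply: leq_sum=> l _; exact: dimvS.
(* No kernel grows, so without a drop of dimension at [e] the two kernels there would coincide,
   which [deform_kernel_strict] excludes. *)
rewrite ltnNge; apply/negP=> le.
have /eqP e1 : (U' (Ordinal es) :&: lker (low_proj (Ordinal es)))%VS ==
   (U (Ordinal es) :&: lker (low_proj (Ordinal es)))%VS by rewrite eqEdim U'K.
have := deform_kernel_strict dim_ext_le dim_ext_out incident_ext dat t0.
rewrite -[e]/(nat_of_ord (Ordinal es)) -GE fam_ext_ord dim_ext_ord.
by move: e1; rewrite /U' ffunE /low_proj => ->; rewrite subvv.
Qed.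

End NatIndexing.

(** * Families in general position *)

Section GenericPoint.
Variables (K : fieldType) (n s : nat) (d : 'I_s -> nat) (U : Defs.family K n s).
Hypotheses (d_len : forall l, (d l <= n)%N)
  (d_le : forall l l' : 'I_s, l' = l.+1 :> nat -> (d l <= d l')%N).
Hypothesis incU : incident d U.

Definition orbit_mx (y : 'M[K]_n) (l : 'I_s) : 'M[K]_(n, d l) :=
  (1%:M + degen (d l) y) *m hw_mx K n (d l).

Lemma orbit_mx_full y l : strict_lower y -> row_full (orbit_mx y l).
Proof.
move=> yl; apply/row_full_inj=> u; rewrite /orbit_mx -mulmxA => e0.
have hu0 : hw_mx K n (d l) *m u = 0.
  rewrite -[LHS]mul1mx.
  have -> : 1%:M = (1%:M - degen (d l) y) *m (1%:M + degen (d l) y).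
    by rewrite mulmxDr mulmx1 mulmxBl mul1mx degen_lower_sqr // subr0 subrK.
  by rewrite -mulmxA e0 mulmx0.
by rewrite -[u]mul1mx -(hw_mx_full K (d_len l)) -mulmxA hu0 mulmx0.
Qed.

(** Each [U l] is a graph over the first [d l] coordinates, with slopes the entries of its reduced
    matrix. Incidence makes these matrices agree where they overlap, so one [y] serves for all
    [l]. *)
Lemma transversal_orbit :
  (forall l, (limg (low_proj K n d l) <= low_proj K n d l @: U l)%VS) ->
  exists2 y : 'M[K]_n, strict_lower y & forall l, U l = colsp (orbit_mx y l).
Proof.
move=> tr; case: (incU) => dimU _.
have H l : exists E : 'M[K]_n, reduced (low (d l)) E /\ colsp E = U l.
  have ker0 x : x \in U l -> cproj K (low (d l)) *m x = 0 -> x = 0.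
    move=> xU x0; apply/eqP; rewrite -memv0.
    (* Rank-nullity: the image has dimension at least [d l = \dim (U l)], so the kernel is 0. *)
    have /eqP <- : (U l :&: lker (low_proj K n d l) == 0)%VS.
      rewrite -dimv_eq0 -(eqn_add2r (\dim (low_proj K n d l @: U l)%VS)) limg_ker_dim add0n.
      rewrite dimU eqn_leq -{1}(card_low (d_len l)) -(dim_cproj K) dimvS ?tr //=.
      by rewrite -(dimU l) -(limg_ker_dim (low_proj K n d l) (U l)) leq_addl.
    by rewrite memv_cap xU memv_ker mxlfunE x0 eqxx.
  have /fin_all_exists[u uP] : forall j, exists u, j \in low (d l) ->
      u \in U l /\ cproj K (low (d l)) *m u = delta_mx j 0.
    move=> j; have [jl|_] := boolP (j \in _); last by exists 0.
    have /memv_imgP[u uU uE] : delta_mx j 0 \in (low_proj K n d l @: U l)%VS.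
      apply: (subvP (tr l)); rewrite -(cproj_delta K jl); exact: mem_colsp.
    by exists u => _; rewrite -mxlfunE -uE.
  by have := reduced_columns ker0 uP; set E := \matrix_(_, _) _ => rE; exists E.
have /fin_all_exists[E EP] : forall l, exists E : 'M[K]_n,
    reduced (low (d l)) E /\ colsp E = U l := H.
have Ecompat (l l' : 'I_s) (i j : 'I_n) : (l <= l')%N -> (j < d l)%N -> (d l' <= i)%N -> E l i j = E l' i j.
  move=> ll' jl il'; case: (EP l) (EP l') => rE cE [rE' cE'].
  have dll' : (d l <= d l')%N.
    have := Dmono (dim_ext_le d_len d_le) ll' (ltnW (ltn_ord l')).
    by rewrite !dim_ext_ord.
  (* [v] lies in [U l'] and its first [d l'] coordinates are those of the basis vector [j], so it is
     column [j] of [E l']. Row [i] is not killed. *)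
  pose v := kill K n (d l) (d l') *m col j (E l).
  have vU : v \in colsp (E l').
    by rewrite cE'; apply: incident_trans => //; rewrite -cE col_colsp.
  have /colP/(_ i) := reduced_fix rE' vU; rewrite /v cproj_mulE !inE.
  rewrite (ltnNge i) il' andbF /= => e.
  move: e; rewrite [RHS]mxE => <-.
  rewrite -(proj1 rE') -mulmxA (mulmxA (cproj K (low (d l')))) low_kill // colE (mulmxA _ (E l)) (proj2 rE).
  rewrite cproj_delta ?inE //. by rewrite -colE mxE (proj1 rE').
(* Any [l] with [j < d l <= i] may be picked, by [Ecompat]. *)
pose y : 'M[K]_n := \matrix_(i, j)
  if [pick l | (j < d l <= i)%N] is Some l then E l i j else 0.
have yE (l : 'I_s) (i j : 'I_n) : (j < d l <= i)%N -> y i j = E l i j.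
  move=> /andP[jl il]; rewrite mxE; case: pickP => [l' /andP[jl' il']|/(_ l)]; last by rewrite jl il.
  by have [ll'|/ltnW ll'] := leqP l l'; [rewrite (Ecompat l l')|rewrite (Ecompat l' l)].
have yl : strict_lower y.
  move=> i j ji; rewrite !mxE; case: pickP => // l /andP[il jl].
  by have := leq_trans il (leq_trans jl ji); rewrite ltnn.
exists y => // l; have [rE cE] := EP l.
have EE : (1%:M + degen (d l) y) *m cproj K (low (d l)) = E l.
  apply/matrixP=> i j; rewrite mul_cprojE inE; case: ltnP => jl; last first.
    by rewrite (reduced_entry0 _ rE) // inE -leqNgt.
  rewrite mxE degen_lowerE // mxE; case: (leqP (d l) i) => il; rewrite ?andbF ?andbT ?jl ?addr0.
    rewrite (yE l) ?jl ?il //.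
    by have [e|_] := eqVneq i j; [rewrite e leqNgt jl in il|rewrite add0r].
  by rewrite (reduced_entry rE) ?inE.
rewrite -cE /orbit_mx -low_hw_mx mulmxA EE.
apply: (colsp_eqP (f := hw_mx K n (d l)) (g := (hw_mx K n (d l))^T)) => //.
by rewrite -mulmxA hw_mx_cproj // (proj1 rE).
Qed.

End GenericPoint.

Lemma segre_pluecker_scale (K : fieldType) n s (d : 'I_s -> nat) (U : Defs.family K n s)
    (t u : tensor K n (slots d)) :
  segre_pluecker U t -> segre_pluecker U u -> exists c : K, t = c *: u.
Proof.
move=> /segre_plueckerP[A [_ UA ->]] /segre_plueckerP[B [_ UB ->]].
have H l : exists M, A l = B l *m M by apply: colsp_subP; rewrite -UA UB.
pose M l := projT1 (cid (H l)).
have AB l : A l = B l *m M l by rewrite /M; case: cid.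
exists (\prod_l \det (M l)); apply/ffunP=> tau; rewrite Segre_wedgeE [RHS]ffunE Segre_wedgeE -[RHS]big_split /=.
by apply: eq_bigr=> l _; rewrite AB rowsub_mulmx det_mulmx mulrC.
Qed.

(** * Density of the orbit among incident families *)

Section Density.
Variables (K : numFieldType) (n s : nat) (d : 'I_s -> nat).
Hypotheses (d_len : forall l, (d l <= n)%N)
  (d_le : forall l l' : 'I_s, l' = l.+1 :> nat -> (d l <= d l')%N).
Variables (F : tensor K n (slots d) -> K) (e : nat).
Hypotheses (F_homog : forall c t, F (c *: t) = c ^+ e * F t)
  (F_poly : forall T : K -> tensor K n (slots d),
     (forall tau, poly_fun (fun x => T x tau)) -> poly_fun (fun x => F (T x)))
  (F_orbit : forall y, strict_lower y -> F (Segre_wedge (orbit_mx d y)) = 0).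

(** Induction on the defect. [F] will be first a linear form whose vanishing helps to put [t] in the
    image of [iota], and then a homogeneous polynomial in the coordinates of the preimage. *)
Lemma orbit_dense U t : incident d U -> segre_pluecker U t -> F t = 0.
Proof.
move: {2}(defect d U).+1 (ltnSn (defect d U)) => m; elim: m U t => [//|m IH] U t Um incU Ut.
have [tr|[x [f def]]] := deform_family d_len d_le incU.
  have [y yl UE] := transversal_orbit d_len d_le incU tr.
  have Uy : segre_pluecker U (Segre_wedge (orbit_mx d y)).
    by apply/segre_plueckerP; exists (orbit_mx d y); split=> // l; exact: orbit_mx_full.
  by have [c ->] := segre_pluecker_scale Ut Uy; rewrite F_homog F_orbit // mulr0.
have /segre_plueckerP[A [fA UA tE]] := Ut.
pose B l (z : K) := (1%:M + z *: (x *m f l)) *m A l.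
pose T z : tensor K n (slots d) := Segre_wedge (fun l => B l z).
have T0 : T 0 = t.
  rewrite tE; apply: eq_Segre => l; congr wedge_mx.
  by rewrite /B scale0r addr0 mul1mx.
(* [F (T z)] is a polynomial in [z] that vanishes for [z != 0] by induction, hence also at 0. *)
rewrite -T0; apply: (poly_fun_eq0 (f := fun z => F (T z))) => [|z z0].
  apply: F_poly; apply: fun_Segre_wedge; [exact: poly_funC|exact: poly_funD|exact: poly_funM|].
  move=> l i j; apply: (fun_mulmx (@poly_funC K) (@poly_funD K) (@poly_funM K)) => a b; last exact: poly_funC.
  have -> : (fun z => (1%:M + z *: (x *m f l)) a b) =
      (fun z : K => (1%:M : 'M[K]_n) a b + z * (x *m f l) a b).
    by apply/funext=> z; rewrite !mxE.
  apply: poly_funD; first exact: poly_funC.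
  apply: poly_funM; [exact: poly_fun_id|exact: poly_funC].
have [G_inj inc' lt] := def z z0.
apply: (IH [ffun l => (mxlfun (1%:M + z *: (x *m f l)) @: U l)%VS]) => //.
  exact: leq_trans lt Um.
apply/segre_plueckerP; exists (fun l => B l z); split=> // l.
  apply/row_full_inj=> u; rewrite /B -mulmxA => e0.
  by apply/(row_full_inj _ (fA l))/(G_inj l); rewrite ?UA ?mem_colsp.
by rewrite ffunE UA limg_colsp.
Qed.

End Density.

Section FlagOfIncident.
Variables (K : numFieldType) (n s : nat) (d : 'I_s -> nat).
Hypotheses (d_len : forall l, (d l <= n)%N)
  (d_le : forall l l' : 'I_s, l' = l.+1 :> nat -> (d l <= d l')%N).

Lemma tensor_form_sum (P : finType) (f : tensor K n P -> K) t : linear (f : tensor K n P -> K^o) ->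
  f t = \sum_tau t tau * f [ffun sg => (sg == tau)%:R].
Proof.
move=> lf; pose L := GRing.isLinear.Build _ _ _ _ _ lf.
pose g : {linear tensor K n P -> K^o} := HB.pack (f : tensor K n P -> K^o) L.
have {1}-> : t = \sum_tau t tau *: ([ffun sg => (sg == tau)%:R] : tensor K n P).
  apply/ffunP=> sg; rewrite sum_ffunE (bigD1 sg) //= big1 ?addr0 => [|tau ts].
    by rewrite !ffunE eqxx [RHS]mulr1.
  by rewrite !ffunE eq_sym (negbTE ts) [LHS]mulr0.
rewrite -[LHS]/(g _) linear_sum; apply: eq_bigr=> tau _.
by rewrite linearZ.
Qed.

Lemma poly_fun_form (P : finType) (f : tensor K n P -> K) (T : K -> tensor K n P) :
  linear (f : tensor K n P -> K^o) -> (forall tau, poly_fun (fun x => T x tau)) ->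
  poly_fun (fun x => f (T x)).
Proof.
move=> lf pT.
have -> : (fun x => f (T x)) =
    (fun x => \sum_tau T x tau * f [ffun sg => (sg == tau)%:R]).
  by apply/funext=> x; exact: tensor_form_sum.
apply: (fun_sum (@poly_funC K) (@poly_funD K)) => tau _.
by apply: poly_funM => //; exact: poly_funC.
Qed.

Lemma meval_homog m (p : {mpoly K[m]}) e c (v : 'I_m -> K) : p \is e.-homog ->
  p.@[fun i => c * v i] = c ^+ e * p.@[v].
Proof.
move=> /dhomogP hp; rewrite !mevalE mulr_sumr; apply: eq_big_seq => a /hp <-.
rewrite mulrCA; congr (_ * _); rewrite /= mdegE -prodrXr -big_split /=.
by apply: eq_bigr=> i _; rewrite exprMn.
Qed.

Lemma degenerate_flag_incident (W : vectType K) (act : {linear 'M[K]_n -> 'End(W)}) (v : W)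
    (iota : {linear W -> tensor K n (slots d)}) U :
  cartan_embedding act v iota -> incident d U -> degenerate_flag act v iota U.
Proof.
move=> emb incU; have c0 : [pchar K] =i pred0 := Num.Theory.pchar_num K.
have [A fA UA] : exists2 A : forall l, 'M[K]_(n, d l),
    forall l, row_full (A l) & forall l, U l = colsp (A l).
  have H l : exists A : 'M[K]_(n, d l), row_full A /\ U l = colsp A.
    by have [A fA UA] := pluecker_exists (proj1 incU l); exists A.
  by exists (fun l => projT1 (cid (H l))) => l; case: cid => B [].
pose t := Segre_wedge A.
have Ut : segre_pluecker U t by apply/segre_plueckerP; exists A.
(* A linear left inverse of [iota], defined on all tensors. That [t] lies in the image of [iota] is
   still to be shown. *)
pose r := ((linfun iota)^-1)%VF.
have rK w : r (iota w) = w.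
  have k0 : lker (linfun iota) == 0%VS.
    by apply/lker0P=> a b; rewrite !lfunE; exact: (iota_inj emb).
  by have := lker0_lfunK k0 w; rewrite lfunE.
(* Each entry of [u - iota (r u)] is a linear form in [u] that vanishes on the orbit, hence at [t]
   by density. *)
have iotar : iota (r t) = t.
  apply/ffunP=> tau; apply/esym/eqP; rewrite -subr_eq0; apply/eqP.
  have lf : linear ((fun u => u tau - iota (r u) tau) : tensor K n (slots d) -> K^o).
    move=> a x y; rewrite !linearP !ffunE scalerBr.
    by rewrite addrACA -opprD.
  apply: (orbit_dense d_len d_le (F := fun u => u tau - iota (r u) tau) (e := 1%N) _ _ _ incU Ut).
  - by move=> c u; rewrite expr1 !linearZ !ffunE mulrBr.
  - by move=> T pT; exact: (poly_fun_form lf).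
  - by move=> y yl; rewrite -(iota_orbit c0 emb yl) rK subrr.
exists (r t); last by rewrite iotar.
split.
  apply/eqP=> r0; have [tau + _] := Segre_wedge_neq0 fA.
  by rewrite -/t -iotar r0 linear0 ffunE eqxx.
move=> e p hp p0.
pose B := vbasis {:W}.
apply: (orbit_dense d_len d_le (F := fun u => p.@[fun i => coord B i (r u)]) (e := e) _ _ _ incU Ut).
- move=> c u; rewrite -meval_homog //; congr (p.@[_]); apply/funext=> i.
  by rewrite !linearZ.
- move=> T pT; apply: (fun_meval (@poly_funC K) (@poly_funD K) (@poly_funM K)) => i.
  apply: (poly_fun_form (f := fun u => coord B i (r u))) => // a x y.
  by rewrite !linearP.
- by move=> y yl; rewrite -(iota_orbit c0 emb yl) rK; apply: p0; exists y.
Qed.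

End FlagOfIncident.

(** * Orbits and Schubert cells *)

Section RotatedOrder.
Variables (K : fieldType) (n d : nat).
Implicit Types (i j k : 'I_n) (L : {set 'I_n}) (E g : 'M[K]_n) (U : {vspace 'cV[K]_n}).

(* Sorting the indices by [rot_rank] gives d+1, ..., n, 1, ..., d in the numbering
   starting at 1; in this order the group acts on the d-th Grassmannian through
   upper triangular matrices. *)
Definition rot_rank (i : 'I_n) : nat := if (i < d)%N then (i + n)%N else i.

Lemma rot_rank_inj : injective rot_rank.
Proof.
move=> i j; rewrite /rot_rank => e; apply: val_inj => /=; have := ltn_ord i; have := ltn_ord j.
by move: e; case: ltnP => _; case: ltnP => _; lia.
Qed.

Definition rot_tri E : Prop := forall i j, E i j != 0 -> (rot_rank i <= rot_rank j)%N.

Lemma rot_tri1 : rot_tri 1%:M.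
Proof. by move=> i j; rewrite mxE; case: (eqVneq i j) => [->|]; rewrite ?eqxx. Qed.

Lemma rot_triD E E' : rot_tri E -> rot_tri E' -> rot_tri (E + E').
Proof.
move=> tE tE' i j; rewrite mxE; have [e|ne _] := eqVneq (E i j) 0; last exact: tE.
by rewrite e add0r; exact: tE'.
Qed.

Lemma rot_triN E : rot_tri E -> rot_tri (- E).
Proof. by move=> tE i j; rewrite mxE oppr_eq0; exact: tE. Qed.

Lemma rot_triM E E' : rot_tri E -> rot_tri E' -> rot_tri (E *m E').
Proof.
move=> tE tE' i j; rewrite mxE => ne; have [k] : exists k, E i k * E' k j != 0.
  apply/existsP; apply: contraR ne; rewrite negb_exists => /forallP e.
  by rewrite big1 // => k _; apply/eqP/negPn/e.
by rewrite mulf_eq0 negb_or => /andP[/tE a /tE' b]; exact: leq_trans b.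
Qed.

Lemma rot_tri_diagM E E' j : rot_tri E -> rot_tri E' -> (E *m E') j j = E j j * E' j j.
Proof.
move=> tE tE'; rewrite mxE (bigD1 j) //= big1 ?addr0 // => k kj.
apply/eqP; apply: contraNT kj; rewrite mulf_eq0 negb_or => /andP[/tE a /tE' b].
by apply/eqP/rot_rank_inj/eqP; rewrite eqn_leq a b.
Qed.

Lemma rot_tri_cproj L : rot_tri (cproj K L).
Proof.
by move=> i j; rewrite mxE; have [->|] := eqVneq i j; rewrite ?leqnn ?eqxx.
Qed.

(** [degen] erases the block with rows before [d] and columns from [d] on; the opposite block lies
    above the diagonal in the rotated order. *)
Lemma rot_tri_degen g : rot_tri (degen d g).
Proof.
move=> i j; rewrite mxE /rot_rank; have := ltn_ord i; have := ltn_ord j.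
by do 4!case: ifP; rewrite ?eqxx //; lia.
Qed.

(** In the entry [j] of [u = E *m u], a nonzero term [E j k * u k 0] needs
    [rot_rank j <= rot_rank k <= rot_rank j]. So [k = j], and column [j] of [E] is nonzero. *)
Lemma lead_mem L E (u : 'cV_n) j : reduced L E -> rot_tri E -> u \in colsp E -> u j 0 != 0 ->
  (forall k, u k 0 != 0 -> (rot_rank k <= rot_rank j)%N) -> j \in L.
Proof.
move=> rE tE uE uj ulead; apply: contraNT uj => jL.
rewrite -(reduced_fix rE uE) mxE big1 // => k _; apply/eqP.
apply: contraNT jL; rewrite mulf_eq0 negb_or => /andP[Ejk uk].
have -> : j = k by apply/rot_rank_inj/eqP; rewrite eqn_leq tE // ulead.
by apply: contraNT Ejk => kL; rewrite (reduced_entry0 _ rE).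
Qed.

Definition schubert L U : Prop := exists E, [/\ reduced L E, rot_tri E & U = colsp E].

Lemma schubert_lead L U j : schubert L U -> j \in L ->
  exists u, [/\ u \in U, u j 0 != 0 & forall k, u k 0 != 0 -> (rot_rank k <= rot_rank j)%N].
Proof.
move=> [E [rE tE ->]] jL; exists (col j E); split; first exact: col_colsp.
  by rewrite mxE (reduced_entry rE) // eqxx oner_eq0.
by move=> k; rewrite mxE => /tE.
Qed.

(** [L] is recovered as the set of leading indices of vectors of [U], the leading index being the
    last one in the rotated order with a nonzero entry. *)
Lemma schubert_uniq L L' U : schubert L U -> schubert L' U -> L = L'.
Proof.
suff H L1 L2 : schubert L1 U -> schubert L2 U -> L1 \subset L2.
  by move=> a b; apply/eqP; rewrite eqEsubset !H.
move=> s1 [E [rE tE UE]]; apply/subsetP=> j /(schubert_lead s1)[u []].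
rewrite UE; exact: lead_mem rE tE.
Qed.

Lemma schubert_exists U : exists L, schubert L U.
Proof.
pose lead j := exists u : 'cV_n,
  [/\ u \in U, u j 0 = 1 & forall k, (rot_rank j < rot_rank k)%N -> u k 0 = 0].
pose L := [set j | `[< lead j >]]; exists L.
(* Gaussian elimination, by induction on a bound for the rank: from a vector with leading index [j]
   subtract multiples of the reduced vectors with smaller leading index. *)
have H m j : j \in L -> (rot_rank j < m)%N -> exists u : 'cV_n,
    [/\ u \in U, cproj K L *m u = delta_mx j 0 & forall k, (rot_rank j < rot_rank k)%N -> u k 0 = 0].
  elim: m j => [//|m IH] j; rewrite inE => /asboolP[w [wU wj wlt]] jm.
  have /fin_all_exists[u uP] : forall i, exists u : 'cV_n, (i \in L) && (rot_rank i < rot_rank j)%N ->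
      [/\ u \in U, cproj K L *m u = delta_mx i 0 & forall k, (rot_rank i < rot_rank k)%N -> u k 0 = 0].
    move=> i; have [/andP[iL ij]|_] := boolP (_ && _); last by exists 0.
    by have [u uP] := IH i iL (leq_trans ij jm); exists u.
  exists (w - \sum_(i | (i \in L) && (rot_rank i < rot_rank j)%N) w i 0 *: u i); split.
  - by rewrite rpredB // rpred_sum // => i /uP[iU _ _]; rewrite rpredZ.
  - apply/colP=> k; rewrite cproj_mulE !mxE summxE eqxx andbT.
    case: ifPn => [kL|kL]; last first.
      by have [e|//] := eqVneq k j; rewrite inE e in kL; case/asboolP: kL; exists w.
    under eq_bigr => i /uP[_ ui _].
      rewrite mxE [u i k 0](_ : _ = (k == i)%:R); last first.
        by have /colP/(_ k) := ui; rewrite cproj_mulE kL mxE eqxx andbT.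
      over.
    have [kj|kj] := ltnP (rot_rank k) (rot_rank j).
      rewrite (bigD1 k) ?kL ?kj //= eqxx mulr1 big1 ?addr0 ?subrr => [|i /andP[_ ik]].
        by have [e|//] := eqVneq k j; rewrite e ltnn in kj.
      by rewrite eq_sym (negbTE ik) mulr0.
    rewrite big1 ?subr0 => [|i /andP[_ ij]]; last first.
      have [e|_] := eqVneq k i; last by rewrite mulr0.
      by rewrite e leqNgt ij in kj.
    have [->//|kj'] := eqVneq k j; apply: wlt; rewrite ltn_neqAle kj andbT.
    by apply: contra kj' => /eqP/rot_rank_inj->.
  move=> k jk; rewrite !mxE summxE wlt // sub0r big1 ?oppr0 // => i iP.
  have [_ _ ui] := uP i iP; rewrite mxE ui ?mulr0 //.
  by case/andP: iP => _ ij; exact: ltn_trans jk.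
have /fin_all_exists[u uP] : forall j, exists u : 'cV_n, j \in L ->
    [/\ u \in U, cproj K L *m u = delta_mx j 0 & forall k, (rot_rank j < rot_rank k)%N -> u k 0 = 0].
  move=> j; have [jL|_] := boolP (j \in L); last by exists 0.
  by have [u uP] := H (rot_rank j).+1 j jL (ltnSn _); exists u.
(* A nonzero vector of [U] has its leading index in [L], and its entry there is nonzero. *)
have ker0 (x : 'cV_n) : x \in U -> cproj K L *m x = 0 -> x = 0.
  move=> xU x0; apply/eqP; apply: contraT => xn0.
  have [j0 j0P] : exists j, x j 0 != 0.
    apply/existsP; apply: contraR xn0; rewrite negb_exists => /forallP e.
    by apply/eqP/colP=> k; rewrite mxE; apply/eqP/negPn/e.
  have [j xj jmax] := @arg_maxnP _ j0 (fun j => x j 0 != 0) rot_rank j0P.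
  have jL : j \in L.
    rewrite inE; apply/asboolP; exists ((x j 0)^-1 *: x).
    split; [exact: rpredZ|by rewrite mxE mulVf|move=> k jk].
    rewrite mxE [x k 0](_ : _ = 0) ?mulr0 //; apply/eqP; apply: contraTT jk => /jmax.
    by rewrite -leqNgt.
  by have /colP/(_ j) := x0; rewrite cproj_mulE jL mxE => e; rewrite e eqxx in xj.
have uP' j : j \in L -> u j \in U /\ cproj K L *m u j = delta_mx j 0 by move=> /uP[].
have := reduced_columns ker0 uP'; set E := \matrix_(_, _) _ => -[rE cE].
exists E; split=> // i j; rewrite mxE; case: ifP => [jL|]; rewrite ?eqxx //.
have [_ _ uj] := uP j jL; rewrite leqNgt; apply: contra => ij.
by rewrite uj.
Qed.

Lemma dim_reduced L E : reduced L E -> \dim (colsp E) = #|L|.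
Proof.
move=> rE; rewrite -(limg_dim_eq (f := mxlfun (cproj K L))).
  by rewrite limg_colsp (proj2 rE) dim_cproj.
apply/eqP; rewrite -subv0; apply/subvP=> x; rewrite memv_cap memv_ker mxlfunE memv0.
move=> /andP[xE /eqP x0]; apply/eqP; rewrite -(reduced_fix rE xE) -(proj1 rE).
by rewrite -mulmxA x0 mulmx0.
Qed.

Lemma dim_schubert L U : schubert L U -> \dim U = #|L|.
Proof. by move=> [E [rE _ ->]]; exact: dim_reduced. Qed.

Lemma coord_spaceE L : coord_space K L = colsp (cproj K L).
Proof.
apply/eqP; rewrite eqEsubv; apply/andP; split.
  apply/span_subvP=> _ /mapP[j jL ->]; rewrite mem_enum in jL.
  by rewrite -(cproj_delta K jL) mem_colsp.
apply/subvP=> _ /colspP[y ->].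
rewrite (_ : cproj K L *m y = \sum_(j in L) y j 0 *: delta_mx j 0).
  apply: rpred_sum => j jL; rewrite rpredZ // memv_span //.
  by apply/mapP; exists j; rewrite ?mem_enum.
apply/colP=> i; rewrite cproj_mulE summxE.
have [iL|iL] := boolP (i \in L).
  rewrite (bigD1 i) //= big1 => [|j /andP[_ ji]]; last first.
    by rewrite !mxE eq_sym (negbTE ji) mulr0.
  by rewrite !mxE !eqxx mulr1 addr0.
rewrite big1 // => j jL; rewrite !mxE; have [e|_] := eqVneq i j; last by rewrite mulr0.
by rewrite e jL in iL.
Qed.

Hypothesis char0 : [pchar K] =i pred0.

Lemma Ga_actE (b y : 'M[K]_n) (A : 'M_(n, d)) : strict_lower y ->
  Ga_act b y (wedge_mx A) = wedge_mx ((1%:M + degen d y) *m degen d b *m A).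
Proof.
move=> yl; rewrite /Ga_act tensor_grp_wedge nilp_exp_tensor_lie //.
  by rewrite tensor_grp_wedge mulmxA.
by move=> _; exact: degen_lower_sqr.
Qed.

Lemma Borel_diag (b : 'M[K]_n) j : in_Borel b -> b j j != 0.
Proof.
move=> [/det_trig bt db]; have : \prod_i b^T i i != 0 by rewrite -bt det_tr db oner_eq0.
by move/prodf_neq0 => /(_ j isT); rewrite mxE.
Qed.

(** The matrix [g] of the group element is triangular in the rotated order with nonzero diagonal, so
    for [j] in [L] its column [j] is a vector of [U] with leading index [j]. Thus [L] is contained
    in the set of leading indices, and both have [d] elements. *)
Lemma schubert_of_orbit L U : #|L| = d -> Ga_orbit d L U -> schubert L U.
Proof.
move=> cL [b [y [bB yl [t /plueckerP[A [fA LA ->]]]]]].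
rewrite Ga_actE //; set g := _ *m degen d b => pU.
have fgA : row_full (g *m A).
  have /plueckerP[B [fB _ e]] := pU; have [tau uB] := row_full_minor fB.
  by apply: (@unit_minor_row_full _ _ _ _ tau); rewrite unitmxE -wedge_mxE e wedge_mxE -unitmxE.
have UE : U = colsp (g *m A) := pluecker_inj pU (pluecker_wedge_mx fgA).
have [L' sL'] := schubert_exists U.
suff -> : L = L' by [].
have tg1 : rot_tri (1%:M + degen d y) := rot_triD rot_tri1 (@rot_tri_degen y).
have tg : rot_tri g := rot_triM tg1 (@rot_tri_degen b).
apply/eqP; rewrite eqEcard -(dim_schubert sL') UE dim_colsp // cL leqnn andbT.
apply/subsetP=> j jL; have [E [rE tE UE']] := sL'.
apply: (lead_mem (u := col j g) rE tE).
- rewrite -UE' UE colE; have /colspP[z ->] : delta_mx j 0 \in colsp A.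
    by rewrite -LA coord_spaceE -(cproj_delta K jL) mem_colsp.
  by rewrite mulmxA mem_colsp.
- rewrite mxE (rot_tri_diagM _ tg1 (@rot_tri_degen b)) mulf_neq0 //.
    rewrite mxE degen_lowerE // mxE eqxx [if _ then _ else _]ifN ?addr0 ?oner_eq0 //.
    by case: ltnP.
  rewrite mxE leqnn [if _ then _ else _]ifT ?Borel_diag //.
  by case: ltnP.
- by move=> k; rewrite mxE => /tg.
Qed.

(** [E] is completed to a matrix [g], unitriangular in the rotated order, which is factored as
    [(1%:M + y) *m b], where [b] consists of the two diagonal blocks of [g] and [y] is supported
    where [j < d <= i]. *)
Lemma orbit_of_schubert L U : #|L| = d -> schubert L U -> Ga_orbit d L U.
Proof.
move=> cL [E [rE tE UE]].
pose g := E + cproj K (~: L).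
have tg : rot_tri g := rot_triD tE (@rot_tri_cproj _).
have gL : g *m cproj K L = E.
  by rewrite mulmxDl (proj1 rE) cprojM_disjoint ?addr0 // -setI_eq0 setIC setICr.
have gjj j : g j j = 1.
  rewrite mxE cprojE inE; have [jL|jL] := boolP (j \in L).
    by rewrite (reduced_entry rE) // eqxx addr0.
  by rewrite (reduced_entry0 _ rE) // eqxx add0r.
pose b : 'M[K]_n := \matrix_(i, j) if (i < d)%N == (j < d)%N then g i j else 0.
have b0 i j : (j < i)%N -> b i j = 0.
  move=> ji; rewrite mxE; case: eqP => // e; apply/eqP; apply: contraLR ji => /tg.
  by move: e; rewrite /rot_rank -leqNgt; case: ltnP => _; case: ltnP => _ //; lia.
have bB : in_Borel b.
  have bt : is_trig_mx b^T by apply/is_trig_mxP=> i j ij; rewrite mxE b0.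
  split=> //; rewrite -det_tr det_trig // big1 // => i _.
  by rewrite mxE [b _ _]mxE eqxx gjj.
have bu : b \in unitmx by rewrite unitmxE (proj2 bB) unitr1.
have db : degen d b = b.
  apply/matrixP=> i j; rewrite mxE; have [ij|ij] := leqP i j.
    case: ifPn => //; rewrite negbK => /andP[id dj].
    by rewrite mxE id ltnNge dj.
  by rewrite b0 // if_same.
pose A : 'M[K]_n := cproj K (low d); pose C : 'M[K]_n := cproj K (~: low d).
have gb : g - b = C *m (g - b) *m A.
  apply/matrixP=> i j; rewrite mul_cprojE cproj_mulE !inE [LHS]mxE [(g - b) i j]mxE ![(- b) i j]mxE ![b i j]mxE.
  have := tg i j; rewrite /rot_rank.
  case: (ltnP i d) => id; case: (ltnP j d) => jd //=; rewrite ?subrr // ?subr0.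
  by move=> H; apply/eqP; apply: contraT => /H; have := ltn_ord j; lia.
have Ab : A *m b = b *m A.
  apply/matrixP=> i j; rewrite cproj_mulE mul_cprojE !inE !mxE.
  by case: (ltnP i d); case: (ltnP j d) => //=.
have Abi : A *m invmx b = invmx b *m A.
  by rewrite -[LHS](mulKmx bu) (mulmxA b) -Ab -(mulmxA A) mulmxV // mulmx1.
(* The solution of [(1%:M + y) *m b = g]. As [g - b] is the off-diagonal block and [invmx b]
   preserves the blocks, [y] is strictly lower triangular. *)
pose y := (g - b) *m invmx b.
have yCA : y = C *m (g - b) *m invmx b *m A by rewrite /y {1}gb -mulmxA Abi !mulmxA.
have y0 i j : ~~ (j < d <= i)%N -> y i j = 0.
  rewrite yCA mul_cprojE inE -!mulmxA cproj_mulE !inE.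
  by case: ltnP => //= jd; rewrite -ltnNge => ->.
have yl : strict_lower y.
  by move=> i j ji; rewrite mxE y0 //; lia.
have dy : degen d y = y.
  by apply/matrixP=> i j; rewrite degen_lowerE //; case: ifPn => // /y0.
have gE : (1%:M + degen d y) *m degen d b = g.
  by rewrite dy db mulmxDl mul1mx /y -mulmxA mulVmx // mulmx1 addrC subrK.
have gu : g \in unitmx.
  rewrite -gE unitmx_mul db bu andbT.
  apply: (proj1 (@mulmx1_unit _ _ _ (1%:M - degen d y) _)).
  by rewrite mulmxBr mulmx1 mulmxDl mul1mx degen_lower_sqr // addr0 addrK.
have [A0 fA0 LA0] : exists2 A0 : 'M[K]_(n, d), row_full A0 & coord_space K L = colsp A0.
  by apply: pluecker_exists; rewrite coord_spaceE dim_cproj.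
exists b, y; split=> //; exists (wedge_mx A0); first by rewrite LA0; exact: pluecker_wedge_mx.
rewrite Ga_actE // gE UE -gL.
have -> : colsp (g *m cproj K L) = colsp (g *m A0).
  by rewrite -!limg_colsp; congr (_ @: _)%VS; exact: etrans (esym (coord_spaceE L)) LA0.
apply: pluecker_wedge_mx; apply/row_full_inj=> u e0; apply/(row_full_inj _ fA0).
by rewrite -[LHS](mulKmx gu) (mulmxA g) e0 mulmx0.
Qed.

End RotatedOrder.

(** Models the columns in [J], a subset of [L], of a reduced triangular matrix for [L], with zeros
    in the other columns. *)
Definition free_part (K : fieldType) n (d : nat) (L J : {set 'I_n}) (F : 'M[K]_n) : Prop :=
  [/\ F *m cproj K J = F, cproj K L *m F = cproj K J & rot_tri d F].

Lemma rot_rank_kill n d d' (i j : 'I_n) : (d <= d')%N -> i \notin gap d d' -> j \notin gap d d' ->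
  (rot_rank d i <= rot_rank d j)%N = (rot_rank d' i <= rot_rank d' j)%N.
Proof.
move=> dd'; rewrite !inE /rot_rank; have := ltn_ord i; have := ltn_ord j.
case: (ltnP i d); case: (ltnP j d); case: (ltnP i d'); case: (ltnP j d') => //=; lia.
Qed.

(** * From the reduced matrix of one subspace to the next *)

Section CellStep.
Variables (K : fieldType) (n d d' : nat) (dd' : (d <= d')%N).
Variables (L L' : {set 'I_n}).
Hypothesis LL' : L :\: gap d d' \subset L'.
Let T := L :\: gap d d'.
Let J := L' :\: T.
Local Notation k := (kill K n d d').

(** By triangularity a column of [E] with index in the gap is supported on rows of the gap, so
    [kill] annihilates it. The rotated orders for [d] and [d'] agree outside the gap. *)
Lemma kill_reduced E : reduced L E -> rot_tri d E -> reduced T (k *m E) /\ rot_tri d' (k *m E).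
Proof.
move=> rE tE.
have kEp : k *m E *m cproj K T = k *m E.
  apply/matrixP=> i j; rewrite mul_cprojE; case: ifPn => // jT; apply/esym.
  rewrite cproj_mulE inE; case: ifPn => // ig.
  have [jL|jL] := boolP (j \in L); last by rewrite (reduced_entry0 _ rE).
  have jg : j \in gap d d' by move: jT; rewrite inE jL andbT negbK.
  apply/eqP; apply: contraNT ig => /tE; move: jg; rewrite !inE /rot_rank.
  by have := ltn_ord i; have := ltn_ord j; case: (ltnP i d); case: (ltnP j d) => //=; lia.
split; first split=> //.
  rewrite mulmxA cprojM_sub; last by apply/subsetP=> i; rewrite !inE => /andP[].
  have TL : T \subset L by exact: subsetDl.
  by rewrite -(cprojM_sub K TL) -mulmxA (proj2 rE).
move=> i j; rewrite -kEp mul_cprojE; case: ifPn => [|_]; last by rewrite eqxx.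
rewrite inE => /andP[jg jL]; rewrite cproj_mulE inE; case: ifPn => [ig|]; last by rewrite eqxx.
by move=> /tE; rewrite (rot_rank_kill dd').
Qed.

Definition next_mx (E F : 'M[K]_n) : 'M[K]_n := F + (1%:M - F) *m (k *m E).

Lemma in_J i : (i \in J) = (i \in L') && (i \notin T).
Proof. by rewrite inE andbC. Qed.

Lemma cprojJT : cproj K L' = cproj K J + cproj K T.
Proof.
apply/matrixP=> i j; rewrite [RHS]mxE !cprojE.
rewrite in_J.
have [iT|iT] := boolP (i \in T); last by rewrite andbT addr0.
by rewrite (subsetP LL' _ iT) add0r.
Qed.

(** The columns of [k *m E] in [J] vanish, so the columns of [E'] in [J] are those of [F]. The
    incidence equation follows from the idempotence of [k *m E]. *)
Lemma next_mxP E F : reduced L E -> rot_tri d E -> free_part d' L' J F ->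
  let E' := next_mx E F in
  [/\ reduced L' E', rot_tri d' E', E' *m (k *m E) = k *m E & E' *m cproj K J = F].
Proof.
move=> rE tE [FJ LF tF] E'; have [rkE tkE] := kill_reduced rE tE.
have [kEp pkE] := rkE.
have pj : cproj K T *m cproj K J = 0.
  by apply: cprojM_disjoint; rewrite -setI_eq0; apply/eqP/setP=> i;
  rewrite in_setI in_set0 in_J; case: (i \in T); rewrite ?andbF.
have kEj : k *m E *m cproj K J = 0 by rewrite -kEp -mulmxA pj mulmx0.
split.
- split.
    have FL : F *m cproj K L' = F by rewrite -FJ -mulmxA cprojM_sub ?subsetDl.
    by rewrite mulmxDl FL -mulmxA {1}cprojJT mulmxDr kEj add0r kEp.
  have LJ : cproj K L' - cproj K J = cproj K T by rewrite cprojJT addrC addKr.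
  by rewrite mulmxDr LF mulmxA mulmxBr mulmx1 LF LJ pkE -cprojJT.
- apply: (rot_triD tF); apply: (rot_triM _ tkE); apply: (rot_triD _ (rot_triN tF)).
  exact: rot_tri1.
- rewrite mulmxDl -mulmxA (reducedM rkE rkE) mulmxBl mul1mx.
  by rewrite addrC subrK.
- by rewrite mulmxDl FJ -mulmxA kEj mulmx0 addr0.
Qed.

(** Split [E'] into its columns [F] in [J] and those in [T]. As [cproj K T *m (k *m E) = cproj K T],
    the incidence equation reads [F *m (k *m E) + E' *m cproj K T = k *m E] and determines the
    latter. *)
Lemma next_mx_unique E E' : reduced L E -> rot_tri d E -> reduced L' E' ->
  E' *m (k *m E) = k *m E -> E' = next_mx E (E' *m cproj K J).
Proof.
move=> rE tE rE' inc; have [[kEp pkE] _] := kill_reduced rE tE.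
have E'T : E' - E' *m cproj K J = E' *m cproj K T.
  by rewrite -{1}(proj1 rE') cprojJT mulmxDr addrC addKr.
rewrite /next_mx mulmxBl mul1mx -{1}inc -mulmxBl E'T -mulmxA pkE.
by rewrite -mulmxDr -cprojJT (proj1 rE').
Qed.

Lemma incident_mx (E E' : 'M[K]_n) : reduced L' E' ->
  (forall u, u \in colsp E -> k *m u \in colsp E') -> E' *m (k *m E) = k *m E.
Proof.
move=> rE' inc; apply/matrixP=> i j.
have kU : k *m col j E \in colsp E' by rewrite inc ?col_colsp.
have colM M : (M *m col j E) i 0 = (M *m E) i j.
  by rewrite !mxE; apply: eq_bigr=> l _; rewrite mxE.
by have /colP/(_ i) := reduced_fix rE' kU; rewrite !mulmxA !colM.
Qed.

End CellStep.

(** For [j] outside the gap, the projection of a vector with leading index [j] still has leading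
    index [j], because the two rotated orders agree outside the gap. *)
Lemma schubert_admissible (K : fieldType) n d d' (L L' : {set 'I_n}) (U U' : {vspace 'cV[K]_n}) :
  (d <= d')%N -> schubert d L U -> schubert d' L' U' ->
  (forall u, u \in U -> kill K n d d' *m u \in U') -> L :\: gap d d' \subset L'.
Proof.
move=> dd' sL [E [rE tE UE]] inc; apply/subsetP=> j; rewrite inE => /andP[jg jL].
have [u [uU uj ulead]] := schubert_lead sL jL.
apply: (lead_mem (u := kill K n d d' *m u) rE tE); first by rewrite -UE inc.
  by rewrite cproj_mulE inE jg.
move=> i; rewrite cproj_mulE inE; case: ifPn => [ig|]; last by rewrite eqxx.
by rewrite -(rot_rank_kill dd') // => /ulead.
Qed.

(** * Coordinates on the cells *)

Section CellParametrization.
Variables (K : fieldType) (n s : nat) (d : 'I_s -> nat) (I : {ffun 'I_s -> {set 'I_n}}).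
Hypotheses (d_le : forall l l' : 'I_s, l' = l.+1 :> nat -> (d l <= d l')%N) (admI : admissible d I).

Definition set_ext (k : nat) : {set 'I_n} := if insub k is Some l then I l else set0.

Lemma set_ext_ord (l : 'I_s) : set_ext l = I l.
Proof. by rewrite /set_ext valK. Qed.

Local Notation D := (dim_ext n d).

(* The other columns of a reduced matrix are determined by the reduced matrix of the
   preceding subspace. *)
Definition free_cols (k : nat) : {set 'I_n} :=
  if k is k'.+1 then set_ext k :\: (set_ext k' :\: gap (D k') (D k)) else set_ext k.

(** Rows in [I l] are fixed by reducedness, and entries below the diagonal in the rotated order
    vanish. *)
Definition free_entry (p : 'I_s * 'I_n * 'I_n) : bool :=
  let: (l, i, j) := p in
  [&& j \in free_cols l, i \notin I l & (rot_rank (d l) i < rot_rank (d l) j)%N].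

Definition param : finType := {p | free_entry p}.
Local Notation N := #|{: param}|.

Lemma free_cols_sub l : free_cols (nat_of_ord l) \subset I l.
Proof.
by rewrite -set_ext_ord /free_cols; case: (nat_of_ord l) => // k; exact: subsetDl.
Qed.

Definition free_val (a : 'rV[K]_N) (p : 'I_s * 'I_n * 'I_n) : K :=
  if insub p is Some q then a 0 (enum_rank (q : param)) else 0.

Definition free_mx (a : 'rV[K]_N) (k : nat) : 'M[K]_n :=
  if (insub k : option 'I_s) is Some l then
    \matrix_(i, j) if j \in free_cols l then (i == j)%:R + free_val a (l, i, j) else 0
  else 0.

Lemma free_mx_ord a (l : 'I_s) i j :
  free_mx a l i j = if j \in free_cols l then (i == j)%:R + free_val a (l, i, j) else 0.
Proof. by rewrite /free_mx valK mxE. Qed.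

Lemma free_val_out a p : ~~ free_entry p -> free_val a p = 0.
Proof. by move=> fp; rewrite /free_val insubN. Qed.

Lemma free_valE a (q : param) : free_val a (val q) = a 0 (enum_rank q).
Proof. by rewrite /free_val valK. Qed.

Lemma free_mxP a (l : 'I_s) : free_part (d l) (I l) (free_cols l) (free_mx a l).
Proof.
split.
- by apply/matrixP=> i j; rewrite mul_cprojE free_mx_ord; case: (j \in _).
- apply/matrixP=> i j; rewrite cproj_mulE free_mx_ord cprojE.
  have /subsetP sJ := free_cols_sub l.
  have [iI|iI] := boolP (i \in I l); last first.
    by rewrite ifN //; apply: contra iI => /sJ.
  rewrite free_val_out /= ?iI ?andbF // addr0.
  have [->|ij] := eqVneq i j; first by [].
  by rewrite !if_same.
- move=> i j; rewrite free_mx_ord; case: ifP => [jJ|]; last by rewrite eqxx.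
  have [->//|ij] := eqVneq i j; rewrite add0r.
  have [|fp] := boolP (free_entry (l, i, j)); last by rewrite free_val_out ?eqxx.
  by move=> /and3P[_ _ /ltnW].
Qed.

Lemma free_mx_exists (F : 'I_s -> 'M[K]_n) :
  (forall l, free_part (d l) (I l) (free_cols (nat_of_ord l)) (F l)) ->
  exists a, forall l : 'I_s, free_mx a l = F l.
Proof.
move=> fF; pose a : 'rV[K]_N := \row_k let: (l, i, j) := val (enum_val k) in F l i j.
exists a => l; apply/matrixP=> i j; rewrite free_mx_ord; have [FJ LF tF] := fF l.
case: ifPn => jJ; last by rewrite -FJ mul_cprojE (negbTE jJ).
have [iI|iI] := boolP (i \in I l).
  rewrite free_val_out /= ?iI ?andbF // addr0.
  have := congr1 (fun M : 'M_n => M i j) LF; rewrite cproj_mulE iI => ->.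
  rewrite cprojE; have [->|ij] := eqVneq i j; first by rewrite jJ.
  by rewrite if_same.
have ij : i != j by apply: contraNneq iI => ->; exact: (subsetP (free_cols_sub l)).
rewrite (negbTE ij) add0r; have [fp|fp] := boolP (free_entry (l, i, j)).
  by rewrite -[(l, i, j)]/(val (Sub (l, i, j) fp : param)) free_valE mxE enum_rankK.
rewrite free_val_out //; apply/esym/eqP; apply: contraNT fp => /tF le.
rewrite /= jJ iI ltn_neqAle le andbT /=; apply: contra ij => /eqP/rot_rank_inj->//.
Qed.

Lemma free_mx_inj a b : (forall l : 'I_s, free_mx a l = free_mx b l) -> a = b.
Proof.
move=> e; apply/rowP=> k; rewrite -[k]enum_valK -!free_valE.
case: (enum_val k) => -[[l i] j] fp /=; have /and3P[jJ iI _] := fp.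
have := congr1 (fun M : 'M_n => M i j) (e l); rewrite !free_mx_ord jJ.
exact: addrI.
Qed.

Fixpoint cell_mx (a : 'rV[K]_N) (k : nat) : 'M[K]_n :=
  if k is k'.+1 then next_mx (D k') (D k) (cell_mx a k') (free_mx a k) else free_mx a 0.

Lemma set_ext_sub k : (k.+1 < s)%N ->
  set_ext k :\: gap (D k) (D k.+1) \subset set_ext k.+1.
Proof.
move=> ks; have k0 := ltnW ks.
rewrite -[k.+1]/(nat_of_ord (Ordinal ks)) -[k]/(nat_of_ord (Ordinal k0)).
by rewrite !set_ext_ord !dim_ext_ord; case: admI => _; apply.
Qed.

Lemma dim_ext_leS k : (k.+1 < s)%N -> (D k <= D k.+1)%N.
Proof.
move=> ks; have k0 := ltnW ks.
rewrite -[k.+1]/(nat_of_ord (Ordinal ks)) -[k]/(nat_of_ord (Ordinal k0)).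
by rewrite !dim_ext_ord; apply: d_le.
Qed.

Lemma free_mx_extP a k : (k < s)%N -> free_part (D k) (set_ext k) (free_cols k) (free_mx a k).
Proof.
move=> ks; rewrite -[k]/(nat_of_ord (Ordinal ks)) set_ext_ord dim_ext_ord.
exact: free_mxP.
Qed.

Lemma cell_mxP a k : (k < s)%N ->
  [/\ reduced (set_ext k) (cell_mx a k), rot_tri (D k) (cell_mx a k) &
      cell_mx a k *m cproj K (free_cols k) = free_mx a k].
Proof.
elim: k => [|k IH] ks; first by have [FJ LF tF] := free_mx_extP a ks; split.
have [rE tE _] := IH (ltnW ks).
by have [] := next_mxP (dim_ext_leS ks) (set_ext_sub ks) rE tE (free_mx_extP a ks).
Qed.

Lemma cell_mx_inc a k : (k.+1 < s)%N ->
  cell_mx a k.+1 *m (kill K n (D k) (D k.+1) *m cell_mx a k) =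
  kill K n (D k) (D k.+1) *m cell_mx a k.
Proof.
move=> ks; have [rE tE _] := cell_mxP a (ltnW ks).
by have [] := next_mxP (dim_ext_leS ks) (set_ext_sub ks) rE tE (free_mx_extP a ks).
Qed.

Lemma cell_mx_reduced a (l : 'I_s) : reduced (I l) (cell_mx a l).
Proof. by have [+ _ _] := cell_mxP a (ltn_ord l); rewrite set_ext_ord. Qed.

Definition cell_point (a : 'rV[K]_N) : Defs.family K n s := [ffun l : 'I_s => colsp (cell_mx a l)].

Lemma cell_point_schubert a l : schubert (d l) (I l) (cell_point a l).
Proof.
rewrite ffunE; have [+ + _] := cell_mxP a (ltn_ord l).
by rewrite set_ext_ord dim_ext_ord; exists (cell_mx a l).
Qed.

Lemma cell_point_incident a : incident d (cell_point a).
Proof.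
split=> [l|l l' ll' u].
  by rewrite (dim_schubert (cell_point_schubert a l)); case: admI.
rewrite !ffunE => /colspP[y ->].
have ks : (l.+1 < s)%N by rewrite -ll'.
have := cell_mx_inc a ks; rewrite -ll' !dim_ext_ord => e.
by rewrite mulmxA -e -mulmxA mem_colsp.
Qed.

(** A reduced matrix is determined by its column space, and its free columns carry the
    parameters. *)
Lemma cell_point_inj : injective cell_point.
Proof.
move=> a b e; apply: free_mx_inj => l.
have [rEa _ <-] := cell_mxP a (ltn_ord l); have [rEb _ <-] := cell_mxP b (ltn_ord l).
by have /ffunP/(_ l) := e; rewrite !ffunE => /(reduced_inj rEa rEb)->.
Qed.

(** The parameters are read off the free columns of the reduced matrices of the [U l]. By induction
    and [next_mx_unique] the recursion reproduces these matrices. *)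
Lemma cell_point_surj U : incident d U -> (forall l, schubert (d l) (I l) (U l)) ->
  exists a, cell_point a = U.
Proof.
move=> [_ incU] schU.
have [E EP] : exists E : 'I_s -> 'M[K]_n, forall l,
    [/\ reduced (I l) (E l), rot_tri (d l) (E l) & U l = colsp (E l)].
  by exists (fun l => projT1 (cid (schU l))) => l; case: cid.
have [a aE] : exists a, forall l : 'I_s, free_mx a l = E l *m cproj K (free_cols l).
  apply: (free_mx_exists (F := fun l => E l *m cproj K (free_cols l))) => l; have [[EL LE] tE _] := EP l; split.
  - by rewrite -mulmxA cproj_idem.
  - by rewrite mulmxA LE cprojM_subr // free_cols_sub.
  - apply: (rot_triM tE); exact: rot_tri_cproj.
exists a; apply/ffunP=> l; rewrite ffunE; have [_ _ ->] := EP l; congr colsp.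
have H k (ks : (k < s)%N) : cell_mx a k = E (Ordinal ks).
  elim: k ks => [|k IH] ks.
    have [[EL _] _ _] := EP (Ordinal ks).
    by have := aE (Ordinal ks); rewrite /= => ->; rewrite -[0%N]/(nat_of_ord (Ordinal ks)) set_ext_ord.
  have k0 := ltnW ks; have [rE tE UE] := EP (Ordinal k0); have [rE' tE' UE'] := EP (Ordinal ks).
  have sub := set_ext_sub ks.
  have inc : E (Ordinal ks) *m (kill K n (D k) (D k.+1) *m E (Ordinal k0)) =
      kill K n (D k) (D k.+1) *m E (Ordinal k0).
    apply: (incident_mx rE'); rewrite -UE -UE' => u uU.
    rewrite -[k.+1]/(nat_of_ord (Ordinal ks)) -[k]/(nat_of_ord (Ordinal k0)) !dim_ext_ord.
    exact: incU uU.
  have fE : free_mx a k.+1 = E (Ordinal ks) *m cproj K (free_cols k.+1) := aE (Ordinal ks).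
  rewrite [LHS](_ : _ = next_mx (D k) (D k.+1) (cell_mx a k) (free_mx a k.+1)) // fE.
  rewrite (IH k0); apply/esym; apply: (next_mx_unique (dim_ext_leS ks) sub) inc.
  - by rewrite -[k]/(nat_of_ord (Ordinal k0)) set_ext_ord.
  - by rewrite -[k]/(nat_of_ord (Ordinal k0)) dim_ext_ord.
  - by rewrite -[k.+1]/(nat_of_ord (Ordinal ks)) set_ext_ord.
rewrite (H l (ltn_ord l)); congr E; exact: val_inj.
Qed.

End CellParametrization.

(** * Regularity of the parametrization and of its inverse *)

Section AffineCell.
Variables (K : fieldType) (n s : nat) (d : 'I_s -> nat) (I : {ffun 'I_s -> {set 'I_n}}).
Hypotheses (d_le : forall l l' : 'I_s, l' = l.+1 :> nat -> (d l <= d l')%N) (admI : admissible d I).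

Local Notation N := #|{: param d I}|.

Definition elem (l : 'I_s) (m : 'I_(d l)) : 'I_n :=
  enum_val (cast_ord (esym (proj1 admI l)) m).

Lemma elem_inj l : injective (@elem l).
Proof. by move=> a b /enum_val_inj/cast_ord_inj. Qed.

Lemma mem_elem l m : @elem l m \in I l.
Proof. exact: enum_valP. Qed.

Lemma elem_onto l j : j \in I l -> exists m, @elem l m = j.
Proof.
move=> jI; exists (cast_ord (proj1 admI l) (enum_rank_in jI j)).
by rewrite /elem cast_ordK enum_rankK_in.
Qed.

Definition cell_basis (a : 'rV[K]_N) (l : 'I_s) : 'M[K]_(n, d l) := colsub (@elem l) (cell_mx a l).

Lemma rowsub_cell_basis a l : rowsub (@elem l) (cell_basis a l) = 1%:M.
Proof.
apply/matrixP=> i j; rewrite !mxE.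
rewrite (reduced_entry (cell_mx_reduced d_le admI a l)) ?mem_elem //.
by rewrite (inj_eq (@elem_inj l)).
Qed.

Lemma cell_basis_full a l : row_full (cell_basis a l).
Proof. by apply: (@unit_minor_row_full _ _ _ _ (@elem l)); rewrite rowsub_cell_basis unitmx1. Qed.

Lemma colsp_cell_basis a l : colsp (cell_basis a l) = colsp (cell_mx a l).
Proof.
have rE := cell_mx_reduced d_le admI a l; apply/eqP; rewrite eqEdim (dim_colsp (cell_basis_full a l)).
rewrite (dim_reduced rE) (proj1 admI l) leqnn andbT; apply/subvP=> x /colspP[y ->].
have -> : cell_basis a l = cell_mx a l *m colsub (@elem l) 1%:M.
  apply/matrixP=> i j; rewrite !mxE (bigD1 (elem j)) //= !mxE eqxx mulr1 big1 ?addr0 // => k kj.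
  by rewrite !mxE (negbTE kj) mulr0.
by rewrite -mulmxA mem_colsp.
Qed.

(** The Segre coordinate at these indices is 1 for every [cell_basis a], so the whole cell lies in a
    single affine chart. *)
Definition cell_chart : {ffun slots d -> 'I_n} := glue elem.

Lemma restrict_cell_chart l : restrict cell_chart l = finfun (@elem l).
Proof. exact: restrict_glue. Qed.

Lemma rowsub_cell_chart a l : rowsub (restrict cell_chart l) (cell_basis a l) = 1%:M.
Proof.
rewrite -(rowsub_cell_basis a l) restrict_cell_chart.
by apply/matrixP=> i j; rewrite !mxE ffunE.
Qed.

Lemma Segre_cell_chart a : Segre_wedge (cell_basis a) cell_chart = 1.
Proof. by rewrite Segre_wedgeE big1 // => l _; rewrite rowsub_cell_chart det1. Qed.

Lemma segre_cell_point a : segre_pluecker (cell_point a) (Segre_wedge (cell_basis a)).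
Proof.
apply/segre_plueckerP; exists (cell_basis a); split=> // l; first exact: cell_basis_full.
by rewrite ffunE colsp_cell_basis.
Qed.

(** The ratio does not depend on the scale of [t], and [cell_basis a] is already normalized in this
    chart. *)
Lemma cell_coordinate (a : 'rV[K]_N) (t : tensor K n (slots d)) l (m : 'I_(d l)) i : segre_pluecker (cell_point a) t ->
  t cell_chart != 0 -> t (set_at cell_chart (slot m) i) / t cell_chart = cell_mx a l i (elem m).
Proof.
move=> /segre_pluecker_scale/(_ (segre_cell_point a))[c ->].
set b := Segre_wedge _; have scE tau : (c *: b) tau = c * b tau by rewrite ffunE.
rewrite !scE [b cell_chart]Segre_cell_chart mulr1 => c0.
rewrite mulrAC mulfV // mul1r.
have := @Segre_wedge_chart _ _ _ _ (cell_basis a) cell_chart l m i.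
rewrite Segre_cell_chart oner_eq0 divr1 rowsub_cell_chart invmx1 mulmx1 => ->//.
by rewrite mxE.
Qed.

Definition row_poly (h : 'rV[K]_N -> K) : Prop :=
  exists q : {mpoly K[N]}, forall b, h b = q.@[fun k => b 0 k].

Lemma row_polyC c : row_poly (fun=> c).
Proof. by exists c%:MP => b; rewrite mevalC. Qed.

Lemma row_polyD f g : row_poly f -> row_poly g -> row_poly (fun x => f x + g x).
Proof. by move=> [p pE] [q qE]; exists (p + q) => x; rewrite mevalD pE qE. Qed.

Lemma row_polyM f g : row_poly f -> row_poly g -> row_poly (fun x => f x * g x).
Proof. by move=> [p pE] [q qE]; exists (p * q) => x; rewrite mevalM pE qE. Qed.

Lemma free_mx_poly k i j : row_poly (fun a => free_mx a k i j).
Proof.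
rewrite /free_mx; case: insub => [l|]; last first.
  have -> : (fun a : 'rV[K]_N => (0 : 'M[K]_n) i j) = (fun=> 0) by apply/funext=> a; rewrite mxE.
  exact: row_polyC.
under eq_fun do rewrite mxE; case: (j \in _); last exact: row_polyC.
apply: row_polyD; first exact: row_polyC.
rewrite /free_val; case: insub => [q|]; last exact: row_polyC.
by exists 'X_(enum_rank q) => b; rewrite mevalXU.
Qed.

Lemma cell_mx_poly k i j : row_poly (fun a => cell_mx a k i j).
Proof.
elim: k i j => [|k IH] i j; first exact: free_mx_poly.
have -> : (fun a : 'rV[K]_N => cell_mx a k.+1 i j) = (fun a => free_mx a k.+1 i j +
    ((1%:M - free_mx a k.+1) *m (kill K n (dim_ext n d k) (dim_ext n d k.+1) *m cell_mx a k)) i j).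
  by apply/funext=> a; rewrite /= mxE.
apply: row_polyD; first exact: free_mx_poly.
apply: (fun_mulmx row_polyC row_polyD row_polyM) => p q; last by apply: (fun_mulmx row_polyC row_polyD row_polyM) => // *; exact: row_polyC.
have -> : (fun a : 'rV[K]_N => (1%:M - free_mx a k.+1) p q) =
    (fun a => (1%:M : 'M[K]_n) p q + (-1) * free_mx a k.+1 p q).
  by apply/funext=> a; rewrite !mxE mulN1r.
apply: row_polyD; first exact: row_polyC.
by apply: row_polyM; [exact: row_polyC|exact: free_mx_poly].
Qed.

Lemma affine_cell_of (C : Defs.family K n s -> Prop) :
  (forall U, C U <-> incident d U /\ forall l, schubert (d l) (I l) (U l)) -> affine_cell d C.
Proof.
(* The inverse is obtained by choice from surjectivity, with the default value 0 off [C]. *)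
move=> CE; pose psi U : 'rV[K]_N :=
  if pselect (exists a : 'rV[K]_N, cell_point a = U) is left h then projT1 (cid h) else 0.
have phiC (a : 'rV[K]_N) : C (cell_point a).
  by apply/CE; split; [exact: (cell_point_incident d_le admI a)|exact: (cell_point_schubert d_le admI a)].
have psiK U : C U -> cell_point (psi U) = U.
  move=> /CE[incU schU]; rewrite /psi; case: pselect => [h|[]]; first by case: cid.
  exact: (cell_point_surj d_le admI incU schU).
exists N, (@cell_point K n s d I), psi; split=> //.
- by move=> a; apply: (cell_point_inj d_le admI); rewrite psiK.
- move=> a.
  have /fin_all_exists[g gE] : forall tau, exists q : {mpoly K[N]},
      forall b, Segre_wedge (cell_basis b) tau = q.@[fun k => b 0 k].
    move=> tau; apply: (fun_Segre_wedge row_polyC row_polyD row_polyM) => l i j.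
    have -> : (fun b : 'rV[K]_N => cell_basis b l i j) = (fun b => cell_mx b l i (elem j)).
      by apply/funext=> b; rewrite mxE.
    exact: cell_mx_poly.
  (* One [g] serves for all base points, because its coordinate at [cell_chart] is constantly 1. *)
  exists g => g_at; have g_atE b : g_at b = Segre_wedge (cell_basis b).
    by apply/ffunP=> tau; rewrite ffunE gE.
  split=> [|b _]; last by rewrite g_atE; exact: segre_cell_point.
  rewrite g_atE; apply/eqP=> /ffunP/(_ cell_chart); rewrite Segre_cell_chart ffunE.
  by move/eqP; rewrite oner_eq0.
move=> k U CU; case E : (enum_val k) => [[[l i] j] fp].
have /and3P[jJ iI _] := fp.
have [m mj] := elem_onto (subsetP (free_cols_sub d I l) _ jJ).
have evalX tau t : tensor_eval ('X_(enum_rank tau)) t = t tau :> K.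
  by rewrite /tensor_eval mevalXU enum_rankK.
(* The parameter at row [i] and column [j = elem m] is the quotient of two Segre coordinates. *)
exists 1%N, 'X_(enum_rank (set_at cell_chart (slot m) i)), 'X_(enum_rank cell_chart); split.
- by rewrite dhomogX /= mdeg1.
- by rewrite dhomogX /= mdeg1.
- exists (Segre_wedge (cell_basis (psi U))); first by rewrite -{1}(psiK U CU); exact: segre_cell_point.
  by rewrite evalX Segre_cell_chart oner_eq0.
move=> U' t CU'; rewrite !evalX -{1}(psiK U' CU') => Ut t0.
rewrite (cell_coordinate _ _ Ut t0) mj.
have [_ _ eJ] := cell_mxP d_le admI (psi U') (ltn_ord l).
have := congr1 (fun M : 'M_n => M i j) eJ; rewrite mul_cprojE jJ => ->.
rewrite free_mx_ord jJ (negbTE (_ : i != j)).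
  by have := free_valE (psi U') (enum_val k); rewrite enum_valK E add0r.
by apply: contraNneq iI => ->; exact: (subsetP (free_cols_sub d I l)).
Qed.

End AffineCell.

Theorem proposition2p14 (R : realType) (n s : nat) (d : 'I_s -> nat)
  (s_gt0 : (0 < s)%N)
  (d_gt0 : forall l, (0 < d l)%N)
  (d_ltn : forall l, (d l < n)%N)
  (d_incr : forall l m : 'I_s, (l < m)%N -> (d l < d m)%N)
  (V : vectType R[i]) (rho : {linear 'M[R[i]]_n -> 'End(V)}) (v : V)
  (V_irr : irreducible_highest_weight rho v
             (fun h => \sum_(l < s) fund_weight (d l) h))
  (Va : vectType R[i]) (gr : nat -> {linear V -> Va})
  (Va_gr : associated_graded rho v gr)
  (act : {linear 'M[R[i]]_n -> 'End(Va)})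
  (Va_act : degenerate_action rho v gr act)
  (iota : {linear Va -> tensor R[i] n (slots d)})
  (iota_emb : cartan_embedding act (gr 0%N v) iota) :
  let Fa := degenerate_flag act (gr 0%N v) iota in
  [/\ forall U, Fa U <-> exists2 I, admissible d I & cell d Fa I U,
      forall I J U, admissible d I -> admissible d J ->
        cell d Fa I U -> cell d Fa J U -> I = J &
      forall I, admissible d I -> affine_cell d (cell d Fa I)].
Proof.
move=> Fa; pose K : numFieldType := R[i].
have char0 : [pchar K] =i pred0 := Num.Theory.pchar_num K.
have d_len l : (d l <= n)%N by exact: ltnW.
have d_le (l l' : 'I_s) : l' = l.+1 :> nat -> (d l <= d l')%N.
  by move=> ll'; apply/ltnW/d_incr; rewrite ll'.
have FaE U : Fa U <-> incident d U.
  split; first exact: (incident_degenerate_flag d_le char0 iota_emb).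
  exact: (@degenerate_flag_incident K _ _ _ d_len d_le _ _ _ _ _ iota_emb).
have cellE I U : admissible d I ->
    cell d Fa I U <-> incident d U /\ forall l, schubert (d l) (I l) (U l).
  move=> [cI _]; split=> [[orb /FaE incU]|[incU sch]]; split=> //.
  - by move=> l; exact: (schubert_of_orbit char0 (cI l)).
  - by move=> l; exact: (orbit_of_schubert char0 (cI l)).
  - exact/FaE.
split=> [U|I J U aI aJ /(cellE _ _ aI)[_ sI] /(cellE _ _ aJ)[_ sJ]|I aI].
- split=> [/FaE incU|[I _ [_ FU]]//].
  (* The index sets consist of the leading indices of the [U l]; incidence makes them admissible. *)
  have /fin_all_exists[f fP] : forall l, exists L, schubert (d l) L (U l).
    by move=> l; exact: schubert_exists.
  have aI : admissible d (finfun f).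
    split=> [l|l l' ll']; rewrite !ffunE.
      by rewrite -(dim_schubert (fP l)); case: incU.
    apply: (schubert_admissible (d_le _ _ ll') (fP l) (fP l')).
    by case: incU => _; apply.
  exists (finfun f) => //; apply/cellE => //; split=> // l; rewrite ffunE; exact: fP.
- by apply/ffunP=> l; exact: schubert_uniq (sI l) (sJ l).
- by apply: (affine_cell_of d_le aI) => U; exact: cellE.
Qed.
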